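(* Let $\mathcal{C}$ be a non-degenerate pivotal fusion category over an algebraically closed field $k$ such that $\mathsf{Gr}_k(\mathcal{C})$ is commutative. Let $V_0=\mathbf{1},V_1,\dots,V_m$ be representatives of the isomorphism classes of simple objects, $\chi_i=\mathsf{ch}(V_i)$, and let $i\mapsto i^*$ be the involution of $\{0,\dots,m\}$ with $V_{i^*}\cong V_i^*$. Let $\mathfrak{C}_0,\dots,\mathfrak{C}_m$ be the conjugacy classes of $\mathcal{C}$, with sizes $|\mathfrak{C}_r|$, normalized class sums $g_r$, and corresponding primitive idempotents $f_r\in\mathsf{CF}(\mathcal{C})$. Then the first orthogonality relation $$\sum_{r=0}^m\frac{|\mathfrak{C}_r|}{\dim(\mathcal{C})}\,\langle\chi_i,g_r\rangle\,\langle\chi_{j^*},g_r\rangle=\delta_{i,j}\qquad(i,j=0,\dots,m)$$ and the second orthogonality relation $$\sum_{i=0}^m\frac{|\mathfrak{C}_r|}{\dim(\mathcal{C})}\,\langle\chi_i,g_r\rangle\,\langle\chi_{i^*},g_s\rangle=\delta_{r,s}\qquad(r,s=0,\dots,m)$$ hold, where $\delta$ is the Kronecker delta. Moreover, for $i=0,\dots,m$, $$\chi_i=\sum_{r=0}^m\langle\chi_i,g_r\rangle\,f_r .$$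
   Context: A fusion category over $k$ is a semisimple rigid monoidal $k$-linear abelian category with finitely many isomorphism classes of simple objects, finite-dimensional Hom spaces, $k$-bilinear $\otimes$, and $\mathrm{End}(\mathbf{1})\cong k$. Monoidal categories are taken strict; $X^*$ is the left dual, with $\mathrm{ev}_X:X^*\otimes X\to\mathbf{1}$, $\mathrm{coev}_X:\mathbf{1}\to X\otimes X^*$; the duality functors $(-)^*$ and ${}^*(-)$ (right dual) are taken strict monoidal and mutually inverse. A pivotal structure is a monoidal isomorphism $j:\mathrm{id}\to(-)^{**}$; put $\widetilde{\mathrm{ev}}_X=\mathrm{ev}_{X^*}\circ(j_X\otimes\mathrm{id}_{X^*})$ and $\dim(X)=\widetilde{\mathrm{ev}}_X\circ\mathrm{coev}_X\in k$. Put $\dim(\mathcal{C})=\sum_i\dim(V_i^* )\dim(V_i)$; $\mathcal{C}$ is non-degenerate if $\dim(\mathcal{C})\ne0$ in $k$. $\mathsf{Gr}_k(\mathcal{C})=k\otimes_{\mathbb{Z}}\mathsf{Gr}(\mathcal{C})$ is the scalar extension of the Grothendieck ring. Central Hopf comonad: $\bar Z(V)=\int_{X\in\mathcal{C}}X\otimes V\otimes X^*$ (end), with universal dinatural transformation $\pi_{V;X}:\bar Z(V)\to X\otimes V\otimes X^*$, comultiplication $\delta$ determined by $(\mathrm{id}_X\otimes\pi_{V;Y}\otimes\mathrm{id}_{X^*})\circ\pi_{\bar Z(V);X}\circ\delta_V=\pi_{V;X\otimes Y}$, counit $\varepsilon_V=\pi_{V;\mathbf{1}}$. The adjoint algebra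 is $A=\bar Z(\mathbf{1})$ with unit $u$ and multiplication $m$ determined by $\pi_{\mathbf{1};X}\circ u=\mathrm{coev}_X$ and $\pi_{\mathbf{1};X}\circ m=(\mathrm{id}_X\otimes\mathrm{ev}_X\otimes\mathrm{id}_{X^*})\circ(\pi_{\mathbf{1};X}\otimes\pi_{\mathbf{1};X})$. The center $\mathcal{Z}(\mathcal{C})$ (objects $(V,\sigma)$, $\sigma_X:V\otimes X\to X\otimes V$) is identified with the category of $\bar Z$-comodules, a comodule $\partial:M\to\bar Z(M)$ having half-braiding $\sigma_X=(\mathrm{id}_X\otimes\mathrm{id}_M\otimes\mathrm{ev}_X)\circ(\pi_{M;X}\otimes\mathrm{id}_X)\circ(\partial\otimes\mathrm{id}_X)$; the right adjoint $R$ of the forgetful functor $U:\mathcal{Z}(\mathcal{C})\to\mathcal{C}$ is $R(V)=(\bar Z(V),\delta_V)$. $\mathsf{CF}(\mathcal{C})=\mathrm{Hom}_{\mathcal{C}}(A,\mathbf{1})$ is an algebra under $f\star g=f\circ\bar Z(g)\circ\delta_{\mathbf{1}}$, and $f\mapsto\tilde f=\bar Z(f)\circ\delta_{\mathbf{1}}$ is an algebra isomorphism $\mathsf{CF}(\mathcal{C})\cong\mathrm{End}_{\mathcal{Z}(\mathcal{C})}(R(\mathbf{1}))$. $\mathsf{CE}(\mathcal{C})=\mathrm{Hom}_{\mathcal{C}}(\mathbf{1},A)$ is an algebra under $a\cdot b=m\circ(a\otimes b)$, isomorphic to $\mathrm{End}(\mathrm{id}_{\mathcal{C}})$ via $\psi(a)_X=\rho_X\circ(a\otimes\mathrm{id}_X)$,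 where $\rho_X=(\mathrm{id}_X\otimes\mathrm{ev}_X)\circ(\pi_{\mathbf{1};X}\otimes\mathrm{id}_X):A\otimes X\to X$. The pairing $\langle f,a\rangle\in k$ is given by $f\circ a=\langle f,a\rangle\,\mathrm{id}_{\mathbf{1}}$. The antipodal operator $\mathfrak{S}$ on $\mathsf{CE}(\mathcal{C})$ corresponds via $\psi$ to $\xi\mapsto\xi^!$, $\xi^!_V=(\xi_{{}^*V})^*$. Internal characters: $\mathsf{ch}(X)=\widetilde{\mathrm{ev}}_X\circ\pi_{\mathbf{1};X}\in\mathsf{CF}(\mathcal{C})$. A cointegral is $\lambda:A\to\mathbf{1}$ with $\bar Z(\lambda)\circ\delta_{\mathbf{1}}=u\circ\lambda$. Let $\lambda$ be the cointegral with $\langle\lambda,u\rangle=1$; explicitly $\lambda=\dim(\mathcal{C})^{-1}\sum_i\dim(V_i^* )\chi_i$. The Fourier transform $\mathfrak{F}_\lambda:\mathsf{CE}(\mathcal{C})\to\mathsf{CF}(\mathcal{C})$, $\mathfrak{F}_\lambda(a)=\lambda\circ m\circ(\mathfrak{S}(a)\otimes\mathrm{id}_A)$, is bijective. Under the assumptions, $R(\mathbf{1})$ is semisimple and multiplicity-free with exactly $m+1$ simple summands. A conjugacy class of $\mathcal{C}$ is a simple direct summand of $R(\mathbf{1})$; they are denoted $\mathfrak{C}_0=\mathbf{1}_{\mathcal{Z}(\mathcal{C})},\mathfrak{C}_1,\dots,\mathfrak{C}_m$. The size $|\mathfrak{C}_r|\in k$ is the pivotal dimension of $\mathfrak{C}_r$;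 it is non-zero. Let $\tilde f_r\in\mathrm{End}(R(\mathbf{1}))$ be the idempotent with image $\mathfrak{C}_r$ and $f_r\in\mathsf{CF}(\mathcal{C})$ the corresponding class function. The class sum is $\overline{\mathfrak{C}}_r=\mathfrak{F}_\lambda^{-1}(f_r)\in\mathsf{CE}(\mathcal{C})$, and $g_r=|\mathfrak{C}_r|^{-1}\overline{\mathfrak{C}}_r$. The matrix $(\langle\chi_i,g_r\rangle)_{i,r}$ is called the character table of $\mathcal{C}$. *)

(* Defs.v *)
From HB Require Import structures.
From mathcomp Require Import all_boot all_order all_algebra.

Set Implicit Arguments.
Unset Strict Implicit.
Unset Printing Implicit Defensive.

Import GRing.Theory.
Local Open Scope ring_scope.

Declare Scope cat_scope.
Delimit Scope cat_scope with cat.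
Local Open Scope cat_scope.

Reserved Notation "g '∘' f" (at level 40, left associativity).
Reserved Notation "X '⊗' Y" (at level 38, right associativity).
Reserved Notation "X '^∨'" (at level 2, left associativity, format "X '^∨'").
Reserved Notation "f '⊠' g" (at level 38, right associativity).

(** * Linear categories with finite-dimensional Hom spaces *)

Record linCat (k : fieldType) := LinCat {
  obj :> Type;
  hom : obj -> obj -> vectType k;
  idm : forall X, hom X X;
  comp : forall X Y Z, hom Y Z -> hom X Y -> hom X Z;
  compA : forall X Y Z W (h : hom Z W) (g : hom Y Z) (f : hom X Y),
    comp h (comp g f) = comp (comp h g) f;
  compIm : forall X Y (f : hom X Y), comp (idm Y) f = f;
  compmI : forall X Y (f : hom X Y), comp f (idm X) = f;
  comp_linearl : forall X Y Z (f : hom X Y), linear (fun g : hom Y Z => comp g f);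
  comp_linearr : forall X Y Z (g : hom Y Z), linear (fun f : hom X Y => comp g f)
}.

Arguments hom {k l}.
Arguments idm {k l}.
Arguments comp {k l X Y Z}.

Notation "g '∘' f" := (comp g f) : cat_scope.

Section LinearCategories.
Context (k : fieldType) (C : linCat k).
Implicit Types X Y Z K W : C.

(* The morphism underlying an equality of objects; in a strict monoidal
   category it plays the role of the associativity and unit constraints
   (coherence is then uniqueness of identity proofs). *)
Definition eqm X Y (p : X = Y) : hom X Y :=
  match p in _ = Z return hom X Z with erefl => idm X end.

Definition inverse_of X Y (f : hom X Y) (g : hom Y X) : Prop :=
  g ∘ f = idm X /\ f ∘ g = idm Y.

Definition iso X Y (f : hom X Y) : Prop := exists g, inverse_of f g.

Definition isomorphic X Y : Prop := exists f : hom X Y, iso f.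

Definition mono X Y (f : hom X Y) : Prop :=
  forall W (g h : hom W X), f ∘ g = f ∘ h -> g = h.

Definition epi X Y (f : hom X Y) : Prop :=
  forall W (g h : hom Y W), g ∘ f = h ∘ f -> g = h.

Definition is_kernel X Y (f : hom X Y) K (i : hom K X) : Prop :=
  f ∘ i = 0 /\
  forall W (g : hom W X), f ∘ g = 0 -> exists! h : hom W K, i ∘ h = g.

Definition is_cokernel X Y (f : hom X Y) K (p : hom Y K) : Prop :=
  p ∘ f = 0 /\
  forall W (g : hom Y W), g ∘ f = 0 -> exists! h : hom K W, h ∘ p = g.

Definition is_direct_sum n (S : 'I_n -> C) X : Prop :=
  exists (i : forall a, hom (S a) X) (p : forall a, hom X (S a)),
    [/\ forall a, p a ∘ i a = idm (S a),
        forall a b, a != b -> p a ∘ i b = 0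
      & \sum_a i a ∘ p a = idm X].

(* The empty family gives a zero object. *)
Definition abelian : Prop :=
  (forall n (S : 'I_n -> C), exists X, is_direct_sum S X) /\
  [/\ forall X Y (f : hom X Y), exists K (i : hom K X), is_kernel f i,
      forall X Y (f : hom X Y), exists K (p : hom Y K), is_cokernel f p,
      forall X Y (f : hom X Y), mono f -> exists Z (g : hom Y Z), is_kernel g f
    & forall X Y (f : hom X Y), epi f -> exists Z (g : hom Z X), is_cokernel g f].

Definition simple X : Prop :=
  idm X <> 0 /\ forall Y (f : hom Y X), mono f -> f = 0 \/ iso f.

Definition semisimple : Prop :=
  forall X, exists n (S : 'I_n -> C),
    (forall a, simple (S a)) /\ is_direct_sum S X.

Definition simple_representatives n (S : 'I_n -> C) : Prop :=
  [/\ forall a, simple (S a),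
      forall a b, isomorphic (S a) (S b) -> a = b
    & forall X, simple X -> exists a, isomorphic X (S a)].

End LinearCategories.

(** * Strict monoidal categories, duals, fusion categories *)

Record monCat (k : fieldType) := MonCat {
  mon_base :> linCat k;
  unit1 : mon_base;
  tens : mon_base -> mon_base -> mon_base;
  tensm : forall X X' Y Y' : mon_base,
    hom X X' -> hom Y Y' -> hom (tens X Y) (tens X' Y');
  tens_linearl : forall (X X' Y Y' : mon_base) (g : hom Y Y'),
    linear (fun f : hom X X' => tensm f g);
  tens_linearr : forall (X X' Y Y' : mon_base) (f : hom X X'),
    linear (fun g : hom Y Y' => tensm f g);
  tensm_id : forall X Y : mon_base, tensm (idm X) (idm Y) = idm (tens X Y);
  tensm_comp : forall (X X' X'' Y Y' Y'' : mon_base)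
      (f' : hom X' X'') (f : hom X X') (g' : hom Y' Y'') (g : hom Y Y'),
    tensm (f' ∘ f) (g' ∘ g) = tensm f' g' ∘ tensm f g;
  tensA : forall X Y Z : mon_base, tens (tens X Y) Z = tens X (tens Y Z);
  tens1o : forall X : mon_base, tens unit1 X = X;
  tenso1 : forall X : mon_base, tens X unit1 = X;
  tensmA : forall (X X' Y Y' Z Z' : mon_base)
      (f : hom X X') (g : hom Y Y') (h : hom Z Z'),
    eqm (tensA X' Y' Z') ∘ tensm (tensm f g) h =
    tensm f (tensm g h) ∘ eqm (tensA X Y Z);
  tensm1f : forall (X Y : mon_base) (f : hom X Y),
    eqm (tens1o Y) ∘ tensm (idm unit1) f = f ∘ eqm (tens1o X);
  tensmf1 : forall (X Y : mon_base) (f : hom X Y),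
    eqm (tenso1 Y) ∘ tensm f (idm unit1) = f ∘ eqm (tenso1 X)
}.

Arguments unit1 {k m}.
Arguments tens {k m}.
Arguments tensm {k m X X' Y Y'}.

Notation "X '⊗' Y" := (tens X Y) : cat_scope.
Notation "f '⊠' g" := (tensm f g) : cat_scope.

Section Constraints.
Context (k : fieldType) (C : monCat k).
Implicit Types X Y Z : C.

Definition asc X Y Z : hom ((X ⊗ Y) ⊗ Z) (X ⊗ Y ⊗ Z) := eqm (tensA X Y Z).
Definition ascV X Y Z : hom (X ⊗ Y ⊗ Z) ((X ⊗ Y) ⊗ Z) :=
  eqm (esym (tensA X Y Z)).
Definition lun X : hom (unit1 ⊗ X) X := eqm (tens1o X).
Definition lunV X : hom X (unit1 ⊗ X) := eqm (esym (tens1o X)).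
Definition run X : hom (X ⊗ unit1) X := eqm (tenso1 X).
Definition runV X : hom X (X ⊗ unit1) := eqm (esym (tenso1 X)).

(* [X'] is a left dual of [X] (equivalently, [X] is a right dual of [X']). *)
Definition duality X' X (e : hom (X' ⊗ X) unit1) (c : hom unit1 (X ⊗ X')) : Prop :=
  run X ∘ (idm X ⊠ e) ∘ asc X X' X ∘ (c ⊠ idm X) ∘ lunV X = idm X /\
  lun X' ∘ (e ⊠ idm X') ∘ ascV X' X X' ∘ (idm X' ⊠ c) ∘ runV X' = idm X'.

(* The transpose Y' -> X' of f : X -> Y for left duals X' of X and Y' of Y. *)
Definition mate X X' Y Y' (c : hom unit1 (X ⊗ X')) (e : hom (Y' ⊗ Y) unit1)
    (f : hom X Y) : hom Y' X' :=
  lun X' ∘ (e ⊠ idm X') ∘ ascV Y' Y X' ∘ (idm Y' ⊠ (f ⊠ idm X'))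
    ∘ (idm Y' ⊠ c) ∘ runV Y'.

(* The isomorphism End(1) = k. *)
Definition scal (f : hom (unit1 : C) unit1) : k :=
  coord [tuple idm (unit1 : C)] ord0 f.

End Constraints.

Record rigidCat (k : fieldType) := RigidCat {
  rigid_base :> monCat k;
  ldual : rigid_base -> rigid_base;
  ev : forall X, hom (ldual X ⊗ X) unit1;
  coev : forall X, hom unit1 (X ⊗ ldual X);
  ldualP : forall X, duality (ev X) (coev X);
  rdual : rigid_base -> rigid_base;
  rev : forall X, hom (X ⊗ rdual X) unit1;
  rcoev : forall X, hom unit1 (rdual X ⊗ X);
  rdualP : forall X, duality (rev X) (rcoev X)
}.

Arguments ev {k r}.
Arguments coev {k r}.
Arguments rev {k r}.
Arguments rcoev {k r}.

Notation "X '^∨'" := (ldual X) : cat_scope.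

Record fusionCat (k : fieldType) := FusionCat {
  fusion_base :> rigidCat k;
  fusion_abelian : abelian fusion_base;
  fusion_semisimple : semisimple fusion_base;
  fusion_finite : exists n (S : 'I_n -> fusion_base), simple_representatives S;
  fusion_unit_neq0 : idm (unit1 : fusion_base) <> 0;
  fusion_unit_scalar : forall f : hom (unit1 : fusion_base) unit1,
    exists c : k, f = c *: idm unit1
}.

(** * Duality functors, pivotal structures, dimensions *)

Section Duality.
Context (k : fieldType) (C : fusionCat k).
Implicit Types X Y V W : C.

Definition dualm X Y (f : hom X Y) : hom (Y^∨) (X^∨) := mate (coev X) (ev Y) f.

Fact tens22A X Y Z W : (X ⊗ Y) ⊗ Z ⊗ W = X ⊗ (Y ⊗ Z) ⊗ W.
Proof. by rewrite !tensA. Qed.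

(* The duality functor is not assumed strict: this is the canonical
   isomorphism, which is an identity under the strictness convention. *)
Definition dual_tens X Y : hom (Y^∨ ⊗ X^∨) ((X ⊗ Y)^∨) :=
  mate (coev (X ⊗ Y))
    (ev Y ∘ (idm (Y^∨) ⊠ (lun Y ∘ (ev X ⊠ idm Y))) ∘ eqm (tens22A (Y^∨) (X^∨) X Y))
    (idm (X ⊗ Y)).

Record pivotal := Pivotal {
  piv : forall X, hom X (X^∨^∨);
  piv_nat : forall X Y (f : hom X Y), piv Y ∘ f = dualm (dualm f) ∘ piv X;
  piv_iso : forall X, iso (piv X);
  piv_tens : forall X Y,
    dualm (dual_tens X Y) ∘ piv (X ⊗ Y) =
    dual_tens (Y^∨) (X^∨) ∘ (piv X ⊠ piv Y)
}.

Definition tev (j : pivotal) X : hom (X ⊗ X^∨) unit1 :=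
  ev (X^∨) ∘ (piv j X ⊠ idm (X^∨)).

Definition pdim (j : pivotal) X : k := scal (tev j X ∘ coev X).

Definition global_dim (j : pivotal) n (V : 'I_n -> C) : k :=
  \sum_i pdim j ((V i)^∨) * pdim j (V i).

(* For [f : hom (rdual X) (rdual X)], the transpose [hom X X] where [X] is
   seen as the left dual of [rdual X]. *)
Definition bang (xi : forall X, hom X X) X : hom X X :=
  mate (rcoev X) (rev X) (xi (rdual X)).

End Duality.

(** * The Grothendieck ring *)

Section Grothendieck.
Context (k : fieldType) (C : fusionCat k) (n : nat) (V : 'I_n -> C).

(* For k algebraically closed, the multiplicity of [V l] in [X]. *)
Definition multiplicity (l : 'I_n) (X : C) : nat := \dim {: hom (V l) X}.

(* The product of R (x)_Z Gr(C), which is free over R on the classes of the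
   [V i]; Gr(C) itself is the case [R = int]. *)
Definition gr_mul (R : comPzRingType) (a b : {ffun 'I_n -> R}) : {ffun 'I_n -> R} :=
  [ffun l => \sum_i \sum_j a i * b j * (multiplicity l (V i ⊗ V j))%:R].

Definition gr_commutative (R : comPzRingType) : Prop :=
  commutative (@gr_mul R).

End Grothendieck.

(** * The central Hopf comonad and the adjoint algebra *)

Section Central.
Context (k : fieldType) (C : fusionCat k).
Implicit Types X Y V W : C.

Definition dinatural V W (g : forall X, hom W (X ⊗ V ⊗ X^∨)) : Prop :=
  forall X Y (f : hom X Y),
    (f ⊠ (idm V ⊠ idm (X^∨))) ∘ g X = (idm Y ⊠ (idm V ⊠ dualm f)) ∘ g Y.

Definition is_end V E (p : forall X, hom E (X ⊗ V ⊗ X^∨)) : Prop :=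
  dinatural p /\
  forall W (g : forall X, hom W (X ⊗ V ⊗ X^∨)), dinatural g ->
    exists! h : hom W E, forall X, p X ∘ h = g X.

Fact comult_eq X Y V W Q : X ⊗ (Y ⊗ V ⊗ W) ⊗ Q = (X ⊗ Y) ⊗ V ⊗ W ⊗ Q.
Proof. by rewrite !tensA. Qed.

Record central_comonad := CentralComonad {
  Zb : C -> C;
  Zpi : forall V X, hom (Zb V) (X ⊗ V ⊗ X^∨);
  Zpi_end : forall V, is_end (Zpi V);
  Zmap : forall V W, hom V W -> hom (Zb V) (Zb W);
  ZmapE : forall V W (f : hom V W) X,
    Zpi W X ∘ Zmap f = (idm X ⊠ (f ⊠ idm (X^∨))) ∘ Zpi V X;
  Zdelta : forall V, hom (Zb V) (Zb (Zb V));
  ZdeltaE : forall V X Y,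
    (idm (X ⊗ Y) ⊠ (idm V ⊠ dual_tens X Y)) ∘ eqm (comult_eq X Y V (Y^∨) (X^∨))
      ∘ (idm X ⊠ (Zpi V Y ⊠ idm (X^∨))) ∘ Zpi (Zb V) X ∘ Zdelta V =
    Zpi V (X ⊗ Y)
}.

Context (Z : central_comonad).

Definition adj : C := Zb Z unit1.

Definition CF := hom adj unit1.
Definition CE := hom unit1 adj.

Definition pi1 X : hom adj (X ⊗ X^∨) := (idm X ⊠ lun (X^∨)) ∘ Zpi Z unit1 X.

Definition adj_act X : hom (adj ⊗ X) X :=
  run X ∘ (idm X ⊠ ev X) ∘ asc X (X^∨) X ∘ (pi1 X ⊠ idm X).

Definition psi (a : CE) X : hom X X := adj_act X ∘ (a ⊠ idm X) ∘ lunV X.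

Record adjoint_algebra := AdjointAlgebra {
  adj_unit : hom unit1 adj;
  adj_unitE : forall X, pi1 X ∘ adj_unit = coev X;
  adj_mul : hom (adj ⊗ adj) adj;
  adj_mulE : forall X,
    pi1 X ∘ adj_mul =
    (idm X ⊠ (lun (X^∨) ∘ (ev X ⊠ idm (X^∨))))
      ∘ eqm (tens22A X (X^∨) X (X^∨)) ∘ (pi1 X ⊠ pi1 X);
  antipode : CE -> CE;
  antipodeE : forall a X, psi (antipode a) X = bang (psi a) X
}.

Definition pairing (f : CF) (a : CE) : k := scal (f ∘ a).

Definition tilde (f : CF) : hom adj adj := Zmap Z f ∘ Zdelta Z unit1.

Definition ch (j : pivotal C) X : CF := tev j X ∘ pi1 X.

Definition cointegral (A : adjoint_algebra) (l : CF) : Prop :=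
  tilde l = adj_unit A ∘ l.

Definition fourier (A : adjoint_algebra) (l : CF) (a : CE) : CF :=
  l ∘ adj_mul A ∘ (antipode A a ⊠ idm adj) ∘ lunV adj.

Definition fourier_inv (A : adjoint_algebra) (l : CF) : CF -> CE :=
  (linfun (fourier A l))^-1%VF.

(** * The center *)

Record zpair := ZPair {
  zob :> C;
  zbr : forall X, hom (zob ⊗ X) (X ⊗ zob)
}.

Implicit Types M N P : zpair.

Definition in_center M : Prop :=
  [/\ forall X, iso (zbr M X),
      forall X Y (f : hom X Y), (f ⊠ idm M) ∘ zbr M X = zbr M Y ∘ (idm M ⊠ f)
    & forall X Y, zbr M (X ⊗ Y) =
        ascV X Y M ∘ (idm X ⊠ zbr M Y) ∘ asc X M Y ∘ (zbr M X ⊠ idm Y)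
          ∘ ascV M X Y].

Definition center_hom M N (f : hom M N) : Prop :=
  forall X, (idm X ⊠ f) ∘ zbr M X = zbr N X ∘ (f ⊠ idm X).

Definition center_iso M N (f : hom M N) : Prop :=
  center_hom f /\ exists2 g : hom N M, center_hom g & inverse_of f g.

Definition center_isomorphic M N : Prop := exists f : hom M N, center_iso f.

Definition center_mono M N (f : hom M N) : Prop :=
  forall P (g h : hom P M), in_center P -> center_hom g -> center_hom h ->
    f ∘ g = f ∘ h -> g = h.

Definition center_simple M : Prop :=
  [/\ in_center M, idm M <> 0
    & forall N (f : hom N M), in_center N -> center_hom f -> center_mono f ->
        f = 0 \/ center_iso f].

Definition center_unit : zpair :=
  @ZPair unit1 (fun X => runV X ∘ lun X).

Fact cofree_eq X V W Q : (X ⊗ V ⊗ W) ⊗ Q = X ⊗ V ⊗ W ⊗ Q.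
Proof. by rewrite !tensA. Qed.

(* The right adjoint R of the forgetful functor. That R(V) satisfies
   [in_center] follows from [Zpi_end] and [ZdeltaE]. *)
Definition cofree V : zpair :=
  @ZPair (Zb Z V) (fun X =>
    (idm X ⊠ (run (Zb Z V) ∘ (idm (Zb Z V) ⊠ ev X)))
      ∘ eqm (cofree_eq X (Zb Z V) (X^∨) X)
      ∘ (Zpi Z (Zb Z V) X ⊠ idm X) ∘ (Zdelta Z V ⊠ idm X)).

(** * Conjugacy classes *)

(* [e] is an idempotent of End_{Z(C)}(N) with image [M]. *)
Definition idempotent_with_image N M (e : hom N N) : Prop :=
  exists (i : hom M N) (p : hom N M),
    [/\ center_hom i, center_hom p, p ∘ i = idm M & i ∘ p = e].

Definition center_summand N M : Prop :=
  exists e : hom N N, idempotent_with_image M e.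

Definition conjugacy_class M : Prop :=
  center_simple M /\ center_summand (cofree unit1) M.

(* [K] lists all conjugacy classes, each exactly once up to isomorphism. *)
Definition conjugacy_classes m (K : 'I_m.+1 -> zpair) : Prop :=
  [/\ forall r, conjugacy_class (K r),
      forall r s, center_isomorphic (K r) (K s) -> r = s,
      forall M, conjugacy_class M -> exists r, center_isomorphic M (K r)
    & center_isomorphic (K ord0) center_unit].

(* [f] is the class function whose image in End_{Z(C)}(R(1)) is the idempotent
   onto [M]. *)
Definition class_idempotent M (f : CF) : Prop :=
  @idempotent_with_image (cofree unit1) M (tilde f).

Definition class_size (j : pivotal C) M : k := pdim j M.

Definition class_sum (A : adjoint_algebra) (l f : CF) : CE := fourier_inv A l f.

Definition norm_class_sum (j : pivotal C) (A : adjoint_algebra) (l : CF) M (f : CF) : CE :=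
  (class_size j M)^-1 *: class_sum A l f.

End Central.

(* Main.v *)
From HB Require Import structures.
From mathcomp Require Import all_boot all_order all_algebra.
From Stdlib Require Import ClassicalEpsilon ProofIrrelevance.
Require Import Defs.

Set Implicit Arguments.
Unset Strict Implicit.
Unset Printing Implicit Defensive.

Import GRing.Theory.
Local Open Scope ring_scope.
Local Open Scope cat_scope.

(** Write i' for the index of the dual of V_i. The key identity is
    T(f ⋆ F(a)) = <f, a> for a class function f and a central element a, where F
    is the Fourier transform and T(f) is the pivotal trace of the endomorphism
    of the adjoint object A attached to f.

    As A is the direct sum of the V_i ⊗ V_i^∨, every class function is a
    combination of the characters chi_i; moreover ch(Y) ⋆ ch(W) = ch(Y ⊗ W), so
    that the product is commutative. In T(ch(Y)) a partial trace produces a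
    morphism from Y to 1, so that T(chi_i) = 0 for nonzero i, while T(chi_0) is
    the dimension of A, that is dim(C). Hence T(chi_i ⋆ chi_l') is dim(C) if
    i = l and 0 otherwise. Applying T to chi_i ⋆ lambda yields the coefficient
    dim(V_i) / dim(C) of the cointegral lambda on chi_i'. Therefore F(a) is the
    sum of the <chi_i, a> / dim(C) chi_i', and the key identity follows.

    On the other hand the f_r are orthogonal idempotents (a product of two of
    them induces an idempotent of a simple object of the center), hence a basis
    of the class functions, and T(f_r) is the size of the r-th class. Thus
    <f_s, g_r> = 1 if r = s and 0 otherwise, the coefficients of chi_i on the
    f_r are the <chi_i, g_r>, the first orthogonality relation computes
    T(chi_i ⋆ chi_j') in this basis, and the second one is its transpose. *)

(** * Bilinearity of composition and of the tensor product *)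

Section LinearFacts.
Context (k : fieldType) (C : linCat k).
Implicit Types X Y Z W : C.

Section Precomp.
Context (X Y Z : C) (f : hom X Y).
Definition precomp (g : hom Y Z) : hom X Z := g ∘ f.
HB.instance Definition _ :=
  GRing.isLinear.Build k (hom Y Z) (hom X Z) *:%R precomp (comp_linearl f).
End Precomp.

Section Postcomp.
Context (X Y Z : C) (g : hom Y Z).
Definition postcomp (f : hom X Y) : hom X Z := g ∘ f.
HB.instance Definition _ :=
  GRing.isLinear.Build k (hom X Y) (hom X Z) *:%R postcomp (comp_linearr g).
End Postcomp.

Lemma comp0m X Y Z (f : hom X Y) : (0 : hom Y Z) ∘ f = 0.
Proof. exact: (linear0 (precomp f)). Qed.
Lemma compm0 X Y Z (g : hom Y Z) : g ∘ (0 : hom X Y) = 0.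
Proof. exact: (linear0 (postcomp g)). Qed.
Lemma compDl X Y Z (f : hom X Y) (g g' : hom Y Z) : (g + g') ∘ f = g ∘ f + g' ∘ f.
Proof. exact: (linearD (precomp f)). Qed.
Lemma compDr X Y Z (f f' : hom X Y) (g : hom Y Z) : g ∘ (f + f') = g ∘ f + g ∘ f'.
Proof. exact: (linearD (postcomp g)). Qed.
Lemma compBl X Y Z (f : hom X Y) (g g' : hom Y Z) : (g - g') ∘ f = g ∘ f - g' ∘ f.
Proof. exact: (linearB (precomp f)). Qed.
Lemma compBr X Y Z (f f' : hom X Y) (g : hom Y Z) : g ∘ (f - f') = g ∘ f - g ∘ f'.
Proof. exact: (linearB (postcomp g)). Qed.
Lemma compZl X Y Z (f : hom X Y) a (g : hom Y Z) : (a *: g) ∘ f = a *: (g ∘ f).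
Proof. exact: (linearZZ (precomp f)). Qed.
Lemma compZr X Y Z a (f : hom X Y) (g : hom Y Z) : g ∘ (a *: f) = a *: (g ∘ f).
Proof. exact: (linearZZ (postcomp g)). Qed.
Lemma comp_suml X Y Z (f : hom X Y) I (r : seq I) (P : pred I) (g : I -> hom Y Z) :
  (\sum_(i <- r | P i) g i) ∘ f = \sum_(i <- r | P i) g i ∘ f.
Proof. exact: (linear_sum (precomp f)). Qed.
Lemma comp_sumr X Y Z (g : hom Y Z) I (r : seq I) (P : pred I) (f : I -> hom X Y) :
  g ∘ (\sum_(i <- r | P i) f i) = \sum_(i <- r | P i) g ∘ f i.
Proof. exact: (linear_sum (postcomp g)). Qed.

End LinearFacts.

Section MonoidalLinear.
Context (k : fieldType) (C : monCat k).
Implicit Types X Y Z W : C.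

Section TensL.
Context (X X' Y Y' : C) (g : hom Y Y').
Definition tensl (f : hom X X') := f ⊠ g.
HB.instance Definition _ :=
  GRing.isLinear.Build k (hom X X') (hom (X ⊗ Y) (X' ⊗ Y')) *:%R tensl
    (@tens_linearl k C X X' Y Y' g).
End TensL.

Section TensR.
Context (X X' Y Y' : C) (f : hom X X').
Definition tensr (g : hom Y Y') := f ⊠ g.
HB.instance Definition _ :=
  GRing.isLinear.Build k (hom Y Y') (hom (X ⊗ Y) (X' ⊗ Y')) *:%R tensr
    (@tens_linearr k C X X' Y Y' f).
End TensR.

Lemma tens0m X X' Y Y' (g : hom Y Y') : (0 : hom X X') ⊠ g = 0.
Proof. exact: (linear0 (tensl g)). Qed.
Lemma tensm0 X X' Y Y' (f : hom X X') : f ⊠ (0 : hom Y Y') = 0.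
Proof. exact: (linear0 (tensr f)). Qed.
Lemma tensDl X X' Y Y' (f f' : hom X X') (g : hom Y Y') : (f + f') ⊠ g = f ⊠ g + f' ⊠ g.
Proof. exact: (linearD (tensl g)). Qed.
Lemma tensDr X X' Y Y' (f : hom X X') (g g' : hom Y Y') : f ⊠ (g + g') = f ⊠ g + f ⊠ g'.
Proof. exact: (linearD (tensr f)). Qed.
Lemma tensZl X X' Y Y' a (f : hom X X') (g : hom Y Y') : (a *: f) ⊠ g = a *: (f ⊠ g).
Proof. exact: (linearZZ (tensl g)). Qed.
Lemma tensZr X X' Y Y' a (f : hom X X') (g : hom Y Y') : f ⊠ (a *: g) = a *: (f ⊠ g).
Proof. exact: (linearZZ (tensr f)). Qed.
Lemma tens_suml X X' Y Y' (g : hom Y Y') I (r : seq I) (P : pred I) (f : I -> hom X X') :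
  (\sum_(i <- r | P i) f i) ⊠ g = \sum_(i <- r | P i) f i ⊠ g.
Proof. exact: (linear_sum (tensl g)). Qed.
Lemma tens_sumr X X' Y Y' (f : hom X X') I (r : seq I) (P : pred I) (g : I -> hom Y Y') :
  f ⊠ (\sum_(i <- r | P i) g i) = \sum_(i <- r | P i) f ⊠ g i.
Proof. exact: (linear_sum (tensr f)). Qed.

Lemma tens_comp_idl X Y Z W (g : hom Y Z) (f : hom X Y) :
  idm W ⊠ (g ∘ f) = (idm W ⊠ g) ∘ (idm W ⊠ f).
Proof. by rewrite -tensm_comp compIm. Qed.
Lemma tens_comp_idr X Y Z W (g : hom Y Z) (f : hom X Y) :
  (g ∘ f) ⊠ idm W = (g ⊠ idm W) ∘ (f ⊠ idm W).
Proof. by rewrite -tensm_comp compIm. Qed.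
Lemma tens_swap X X' Y Y' (f : hom X X') (g : hom Y Y') :
  (f ⊠ idm Y') ∘ (idm X ⊠ g) = (idm X' ⊠ g) ∘ (f ⊠ idm Y).
Proof. by rewrite -!tensm_comp !compIm !compmI. Qed.
Lemma tens_lr X X' Y Y' (f : hom X X') (g : hom Y Y') :
  (f ⊠ idm Y') ∘ (idm X ⊠ g) = f ⊠ g.
Proof. by rewrite -!tensm_comp !compIm !compmI. Qed.
Lemma tens_rl X X' Y Y' (f : hom X X') (g : hom Y Y') :
  (idm X' ⊠ g) ∘ (f ⊠ idm Y) = f ⊠ g.
Proof. by rewrite -!tensm_comp !compIm !compmI. Qed.

End MonoidalLinear.

(** * Morphisms up to equality of objects *)

(* Packing the endpoints turns the strictness of the tensor product into
   Leibniz equalities of arrows, free of coherence morphisms. *)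
Record arr (k : fieldType) (C : linCat k) :=
  Arr { dom : C; cod : C; mor : hom dom cod }.
Arguments Arr {k C dom cod}.

(* Composition is made total by inserting [0] between distinct objects, so
   that associativity holds unconditionally. *)
Definition cast (k : fieldType) (C : linCat k) (X Y : C) : hom X Y :=
  match excluded_middle_informative (X = Y) with
  | left p => eqm p
  | right _ => 0
  end.

HB.lock Definition acomp (k : fieldType) (C : monCat k) (G F : arr C) : arr C :=
  Arr (mor G ∘ cast (cod F) (dom G) ∘ mor F).
HB.lock Definition atens (k : fieldType) (C : monCat k) (F G : arr C) : arr C :=
  Arr (mor F ⊠ mor G).
HB.lock Definition aid (k : fieldType) (C : monCat k) (X : C) : arr C := Arr (idm X).
Arguments acomp {k C}.
Arguments atens {k C}.
Arguments aid {k C}.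

Notation "G • F" := (acomp G F) (at level 40, left associativity) : cat_scope.
Notation "F ⊛ G" := (atens F G) (at level 38, right associativity) : cat_scope.
Notation "⌜ f ⌝" := (Arr f) (at level 0, f at level 99, format "⌜ f ⌝") : cat_scope.

Section Packing.
Context (k : fieldType) (C : monCat k).
Implicit Types (X Y Z W : C) (F G H : arr C).

Lemma eqm_id X (p : X = X) : eqm p = idm X.
Proof. by rewrite (proof_irrelevance _ p erefl). Qed.

Lemma cast_eqm X Y (p : X = Y) : cast X Y = eqm p.
Proof.
rewrite /cast; case: excluded_middle_informative => [q | /(_ p)//].
by rewrite (proof_irrelevance _ q p).
Qed.

Lemma cast_id X : cast X X = idm X. Proof. by rewrite (cast_eqm erefl). Qed.

(** Packed arrows are compared up to transport along equalities of endpoints, and uniqueness of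
    identity proofs trivializes the transport. Computations with packed arrows thus descend to
    morphisms. *)
Lemma arr_inj X Y (f g : hom X Y) : ⌜f⌝ = ⌜g⌝ -> f = g.
Proof.
move=> E; have aux F G : F = G ->
    forall (p : dom F = dom G) (q : cod F = cod G), eqm q ∘ mor F = mor G ∘ eqm p.
  by move=> -> p q; rewrite !eqm_id compIm compmI.
by have := aux _ _ E erefl erefl; rewrite /= compIm compmI.
Qed.

Lemma arr_comp X Y Z (g : hom Y Z) (f : hom X Y) : ⌜g ∘ f⌝ = ⌜g⌝ • ⌜f⌝.
Proof. by rewrite !unlock /= cast_id compmI. Qed.

Lemma arr_tens X X' Y Y' (f : hom X X') (g : hom Y Y') :
  ⌜f ⊠ g⌝ = ⌜f⌝ ⊛ ⌜g⌝.
Proof. by rewrite unlock. Qed.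

Lemma arr_id X : ⌜idm X⌝ = aid X. Proof. by rewrite unlock. Qed.

Lemma arr_eqm X Y (p : X = Y) : ⌜eqm p⌝ = aid X.
Proof. by case: Y / p; rewrite unlock. Qed.

Lemma arr_eqml X Y Z (p : Y = Z) (f : hom X Y) : ⌜eqm p ∘ f⌝ = ⌜f⌝.
Proof. by case: Z / p; rewrite /= compIm. Qed.

Lemma arr_eqmr X Y Z (p : X = Y) (f : hom Y Z) : ⌜f ∘ eqm p⌝ = ⌜f⌝.
Proof. by case: Y / p f => f; rewrite /= compmI. Qed.

Lemma dom_acomp G F : dom (G • F) = dom F.
Proof. by rewrite unlock. Qed.
Lemma cod_acomp G F : cod (G • F) = cod G.
Proof. by rewrite unlock. Qed.
Lemma dom_atens F G : dom (F ⊛ G) = dom F ⊗ dom G.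
Proof. by rewrite unlock. Qed.
Lemma cod_atens F G : cod (F ⊛ G) = cod F ⊗ cod G.
Proof. by rewrite unlock. Qed.
Lemma dom_aid X : dom (aid X) = X.
Proof. by rewrite unlock. Qed.
Lemma cod_aid X : cod (aid X) = X.
Proof. by rewrite unlock. Qed.

End Packing.

Ltac side := solve [rewrite ?(dom_acomp, cod_acomp, dom_atens, cod_atens, dom_aid, cod_aid) /=
  ?(tens1o, tenso1) ?tensA; reflexivity].

#[local] Hint Extern 0 (@eq (obj _) _ _) => side : core.

Section Arrows.
Context (k : fieldType) (C : monCat k).
Implicit Types (X Y Z W : C) (F G H : arr C).

Lemma acompA H G F : H • (G • F) = H • G • F.
Proof. by rewrite !unlock /= !compA. Qed.

Lemma aidl X F : cod F = X -> aid X • F = F.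
Proof. by case: F => A B f /= <-; rewrite !unlock /= cast_id !compIm. Qed.

Lemma aidr X F : dom F = X -> F • aid X = F.
Proof. by case: F => A B f /= <-; rewrite !unlock /= cast_id !compmI. Qed.

Lemma atens_comp F' F G' G : cod F = dom F' -> cod G = dom G' ->
  (F' ⊛ G') • (F ⊛ G) = (F' • F) ⊛ (G' • G).
Proof.
case: F' F G' G => [A' B' f'] [A B f] [U' W' g'] [U W g] /= E1 E2.
case: A' / E1 f' => f'; case: U' / E2 g' => g'.
by rewrite !unlock /= !cast_id !compmI tensm_comp.
Qed.

Lemma atens_id X Y : aid X ⊛ aid Y = aid (X ⊗ Y).
Proof. by rewrite !unlock /= tensm_id. Qed.

Lemma eqm_arr X Y X' Y' (p : X = X') (q : Y = Y') (f : hom X Y) (g : hom X' Y') :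
  eqm q ∘ f = g ∘ eqm p -> ⌜f⌝ = ⌜g⌝.
Proof. by move=> E; rewrite -(arr_eqml q) E arr_eqmr. Qed.

Lemma atensA F G H : (F ⊛ G) ⊛ H = F ⊛ G ⊛ H.
Proof.
case: F G H => [A B f] [A' B' g] [A'' B'' h].
by rewrite !unlock; apply: eqm_arr (tensmA f g h).
Qed.

Lemma atens1l F : aid unit1 ⊛ F = F.
Proof. by case: F => A B f; rewrite !unlock; apply: eqm_arr (tensm1f f). Qed.

Lemma atens1r F : F ⊛ aid unit1 = F.
Proof. by case: F => A B f; rewrite !unlock; apply: eqm_arr (tensmf1 f). Qed.

(** Half of the interchange law. [X] and [Y] enter through equations, so that they need to match the
    endpoints only up to strictness. *)
Lemma atens_lr F G X Y : X = cod G -> Y = dom F ->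
  (F ⊛ aid X) • (aid Y ⊛ G) = F ⊛ G.
Proof. by move=> -> ->; rewrite atens_comp // ?aidl // aidr. Qed.

Lemma atens_rl F G X Y : X = cod F -> Y = dom G ->
  (aid X ⊛ G) • (F ⊛ aid Y) = F ⊛ G.
Proof. by move=> -> ->; rewrite atens_comp // ?aidl // aidr. Qed.

Lemma acomp_whiskerl X G F : cod F = dom G ->
  aid X ⊛ (G • F) = (aid X ⊛ G) • (aid X ⊛ F).
Proof. by move=> E; rewrite atens_comp // aidl. Qed.

Lemma acomp_whiskerr X G F : cod F = dom G ->
  (G • F) ⊛ aid X = (G ⊛ aid X) • (F ⊛ aid X).
Proof. by move=> E; rewrite atens_comp // aidl. Qed.

End Arrows.

Arguments atens_lr {k C}.
Arguments atens_rl {k C}.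

(* The goal is matched syntactically, so that defined morphisms stay folded. *)
Ltac pack := try apply: arr_inj; rewrite /asc /ascV /lun /lunV /run /runV;
  repeat match goal with
  | |- context [Arr (comp (eqm ?p) ?f)] => rewrite (arr_eqml p f)
  | |- context [Arr (comp ?f (eqm ?p))] => rewrite (arr_eqmr p f)
  | |- context [Arr (comp ?g ?f)] => rewrite (arr_comp g f)
  | |- context [Arr (tensm ?f ?g)] => rewrite (arr_tens f g)
  | |- context [Arr (idm ?X)] => rewrite (arr_id X)
  | |- context [Arr (eqm ?p)] => rewrite (arr_eqm p)
  end.

Section Slides.
Context (k : fieldType) (C : monCat k).
Implicit Types (X Y Z W : C) (F G E : arr C).

(* A morphism to, or from, the unit object slides past any morphism. *)
Lemma evr E F X : cod E = unit1 -> X = dom F -> F • (aid X ⊛ E) = F ⊛ E.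
Proof. by move=> E1 ->; rewrite -{1}[F]atens1r atens_lr ?E1. Qed.

Lemma evl E F X : cod E = unit1 -> X = dom F -> F • (E ⊛ aid X) = E ⊛ F.
Proof. by move=> E1 ->; rewrite -{1}[F]atens1l atens_rl ?E1. Qed.

Lemma coevr E F X : dom E = unit1 -> X = cod F -> (aid X ⊛ E) • F = F ⊛ E.
Proof. by move=> E1 ->; rewrite -{2}[F]atens1r atens_rl ?E1. Qed.

Lemma coevl E F X : dom E = unit1 -> X = cod F -> (E ⊛ aid X) • F = E ⊛ F.
Proof. by move=> E1 ->; rewrite -{2}[F]atens1l atens_lr ?E1. Qed.

Lemma coev_ev E F : dom E = unit1 -> cod F = unit1 -> E • F = E ⊛ F.
Proof. by move=> E1 F1; rewrite -{1}[E]atens1r -{1}[F]atens1l atens_lr ?E1. Qed.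

Lemma coev_ev' E F : dom E = unit1 -> cod F = unit1 -> E • F = F ⊛ E.
Proof. by move=> E1 F1; rewrite -{1}[E]atens1l -{1}[F]atens1r atens_rl ?E1. Qed.

End Slides.

Arguments evr {k C}.
Arguments evl {k C}.
Arguments coevr {k C}.
Arguments coevl {k C}.

(** * Duality *)

Section Dualities.
Context (k : fieldType) (C : monCat k).
Implicit Types X Y Z W : C.

Lemma dualityP X' X (e : hom (X' ⊗ X) unit1) (c : hom unit1 (X ⊗ X')) :
  duality e c <->
  (aid X ⊛ Arr e) • (Arr c ⊛ aid X) = aid X /\
  (Arr e ⊛ aid X') • (aid X' ⊛ Arr c) = aid X'.
Proof.
split=> -[E1 E2]; split.
- by have := congr1 Arr E1; pack.
- by have := congr1 Arr E2; pack.
- by pack.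
- by pack.
Qed.

Lemma duality_zig X' X (e : hom (X' ⊗ X) unit1) (c : hom unit1 (X ⊗ X')) :
  duality e c -> (aid X ⊛ Arr e) • (Arr c ⊛ aid X) = aid X.
Proof. by move/dualityP=> []. Qed.

Lemma duality_zag X' X (e : hom (X' ⊗ X) unit1) (c : hom unit1 (X ⊗ X')) :
  duality e c -> (Arr e ⊛ aid X') • (aid X' ⊛ Arr c) = aid X'.
Proof. by move/dualityP=> []. Qed.

(** Evaluations on disjoint strands commute, so [eX] can be applied before [e]; it then meets [cX],
    and the zigzag identity straightens the strand. *)
Lemma mate_ev X' X Y' Y (eX : hom (X' ⊗ X) unit1) (cX : hom unit1 (X ⊗ X'))
  (e : hom (Y' ⊗ Y) unit1) (f : hom X Y) : duality eX cX ->
  eX ∘ (mate cX e f ⊠ idm X) = e ∘ (idm Y' ⊠ f).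
Proof.
move=> D; rewrite /mate; pack.
rewrite !acomp_whiskerr //.
rewrite !atensA !acompA atens_id (evl ⌜e⌝ ⌜eX⌝) // -(evr ⌜eX⌝ ⌜e⌝ (Y' ⊗ Y)) //.
have -> : ⌜e⌝ • (aid (Y' ⊗ Y) ⊛ ⌜eX⌝) • (aid Y' ⊛ (⌜f⌝ ⊛ aid (X' ⊗ X)))
   = ⌜e⌝ • (aid Y' ⊛ ⌜f⌝) • (aid Y' ⊛ (aid X ⊛ ⌜eX⌝)).
  rewrite -(atens_id Y') atensA -!acompA -!acomp_whiskerl //.
  by rewrite atens_rl // (evr ⌜eX⌝).
rewrite -acompA -acomp_whiskerl ?duality_zig //.
by rewrite atens_id aidr.
Qed.

Lemma mate_coev X' X Y' Y (eY : hom (Y' ⊗ Y) unit1) (cY : hom unit1 (Y ⊗ Y'))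
  (c : hom unit1 (X ⊗ X')) (f : hom X Y) : duality eY cY ->
  (idm Y ⊠ mate c eY f) ∘ cY = (f ⊠ idm X') ∘ c.
Proof.
move=> D; rewrite /mate; pack.
rewrite !acomp_whiskerl //.
rewrite -!atensA -!acompA atens_id (coevr ⌜c⌝ ⌜cY⌝) // -(coevl ⌜cY⌝ ⌜c⌝ (X ⊗ X')) // !acompA.
have -> : ((aid Y ⊛ ⌜eY⌝) ⊛ aid X') • ((aid (Y ⊗ Y') ⊛ ⌜f⌝) ⊛ aid X') •
    (⌜cY⌝ ⊛ aid (X ⊗ X')) = (((aid Y ⊛ ⌜eY⌝) • (⌜cY⌝ ⊛ aid Y)) ⊛ aid X') • (⌜f⌝ ⊛ aid X').
  rewrite -(atens_id X) -(atensA ⌜cY⌝) -!acomp_whiskerr //.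
  by rewrite -!acompA atens_rl // (coevl ⌜cY⌝).
by rewrite duality_zig // atens_id aidl.
Qed.

(** A morphism into a dual is recovered from its pairing with [X] by means of the coevaluation. *)
Lemma ev_inj X' X W (e : hom (X' ⊗ X) unit1) (c : hom unit1 (X ⊗ X')) (a b : hom W X') :
  duality e c -> e ∘ (a ⊠ idm X) = e ∘ (b ⊠ idm X) -> a = b.
Proof.
move=> D; suff E (a' : hom W X') :
    ⌜a'⌝ = (⌜e ∘ (a' ⊠ idm X)⌝ ⊛ aid X') • (aid W ⊛ ⌜c⌝).
  by move=> H; apply: arr_inj; rewrite E H -E.
pack; rewrite acomp_whiskerr //.
rewrite -acompA atensA atens_id atens_lr //.
by rewrite -(coevr ⌜c⌝ ⌜a'⌝ X') // acompA duality_zag // aidl.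
Qed.

Lemma coev_injl X' X W (e : hom (X' ⊗ X) unit1) (c : hom unit1 (X ⊗ X')) (a b : hom X W) :
  duality e c -> (a ⊠ idm X') ∘ c = (b ⊠ idm X') ∘ c -> a = b.
Proof.
move=> D; suff E (a' : hom X W) :
    ⌜a'⌝ = (aid W ⊛ ⌜e⌝) • (⌜(a' ⊠ idm X') ∘ c⌝ ⊛ aid X).
  by move=> H; apply: arr_inj; rewrite E H -E.
pack; rewrite acomp_whiskerr //.
rewrite acompA atensA atens_id atens_rl // -(evr ⌜e⌝ ⌜a'⌝ X) //.
by rewrite -acompA duality_zig // aidr.
Qed.

Lemma duality_tens X' X Y' Y (eX : hom (X' ⊗ X) unit1) (cX : hom unit1 (X ⊗ X'))
    (eY : hom (Y' ⊗ Y) unit1) (cY : hom unit1 (Y ⊗ Y'))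
    (e : hom ((Y' ⊗ X') ⊗ (X ⊗ Y)) unit1) (c : hom unit1 ((X ⊗ Y) ⊗ (Y' ⊗ X'))) :
  duality eX cX -> duality eY cY ->
  ⌜e⌝ = ⌜eY⌝ • (aid Y' ⊛ ⌜eX⌝ ⊛ aid Y) ->
  ⌜c⌝ = (aid X ⊛ ⌜cY⌝ ⊛ aid X') • ⌜cX⌝ ->
  duality e c.
Proof.
move=> DX DY Ee Ec; apply/dualityP; rewrite Ee Ec.
rewrite !acomp_whiskerl // !acomp_whiskerr // -!atens_id !atensA !acompA; split.
(* The evaluation for [X] and the coevaluation for [Y] pass through the unit object, hence commute;
   what remains is one zigzag for each factor. *)
- have mid : (aid X ⊛ aid Y ⊛ aid Y' ⊛ ⌜eX⌝ ⊛ aid Y)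
      • (aid X ⊛ ⌜cY⌝ ⊛ aid X' ⊛ aid X ⊛ aid Y)
    = (aid X ⊛ ⌜cY⌝ ⊛ aid Y) • (aid X ⊛ ⌜eX⌝ ⊛ aid Y).
    rewrite -!acomp_whiskerl //; congr (_ ⊛ _).
    rewrite -!(atensA _ _ (aid Y)) -!acomp_whiskerr //; congr (_ ⊛ _).
    by rewrite -!atensA atens_id atensA atens_id atens_rl // coev_ev.
  rewrite -(acompA (aid X ⊛ aid Y ⊛ ⌜eY⌝)) mid acompA -acompA.
  rewrite -acomp_whiskerl // duality_zig // -!atensA -acomp_whiskerr // duality_zig //.
  by rewrite !atens_id aidl.
- have mid : (aid Y' ⊛ ⌜eX⌝ ⊛ aid Y ⊛ aid Y' ⊛ aid X')
      • (aid Y' ⊛ aid X' ⊛ aid X ⊛ ⌜cY⌝ ⊛ aid X')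
    = (aid Y' ⊛ ⌜cY⌝ ⊛ aid X') • (aid Y' ⊛ ⌜eX⌝ ⊛ aid X').
    rewrite -!acomp_whiskerl //; congr (_ ⊛ _).
    rewrite -!(atensA _ _ (aid X')) -!acomp_whiskerr //; congr (_ ⊛ _).
    by rewrite -!atensA atens_id atensA atens_id atens_lr // coev_ev'.
  rewrite -(acompA (⌜eY⌝ ⊛ _)) mid acompA -acompA.
  rewrite -acomp_whiskerl // duality_zag // -!atensA -acomp_whiskerr // duality_zag //.
  by rewrite !atens_id aidl.
Qed.

End Dualities.

Section DualFunctor.
Context (k : fieldType) (C : fusionCat k).
Implicit Types X Y Z W : C.

Lemma ev_dualm X Y (f : hom X Y) :
  ev X ∘ (dualm f ⊠ idm X) = ev Y ∘ (idm (Y^∨) ⊠ f).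
Proof. exact/mate_ev/ldualP. Qed.

Lemma coev_dualm X Y (f : hom X Y) :
  (f ⊠ idm (X^∨)) ∘ coev X = (idm Y ⊠ dualm f) ∘ coev Y.
Proof. by rewrite mate_coev //; apply: ldualP. Qed.

Lemma dualm_id X : dualm (idm X) = idm (X^∨).
Proof. by apply: ev_inj (ldualP X) _; rewrite ev_dualm. Qed.

Lemma dualm_comp X Y Z (g : hom Y Z) (f : hom X Y) :
  dualm (g ∘ f) = dualm f ∘ dualm g.
Proof.
apply: ev_inj (ldualP X) _; rewrite tens_comp_idr compA !ev_dualm -compA -tens_swap.
by rewrite compA ev_dualm tens_comp_idl compA.
Qed.

Definition ev_tens X Y : hom ((Y^∨ ⊗ X^∨) ⊗ (X ⊗ Y)) unit1 :=
  ev Y ∘ (idm (Y^∨) ⊠ (lun Y ∘ (ev X ⊠ idm Y))) ∘ eqm (tens22A (Y^∨) (X^∨) X Y).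

Definition coev_tens X Y : hom unit1 ((X ⊗ Y) ⊗ (Y^∨ ⊗ X^∨)) :=
  eqm (esym (tens22A X Y (Y^∨) (X^∨))) ∘ (idm X ⊠ ((coev Y ⊠ idm (X^∨)) ∘ lunV (X^∨)))
    ∘ coev X.

Lemma arr_ev_tens X Y : ⌜ev_tens X Y⌝ = ⌜ev Y⌝ • (aid (Y^∨) ⊛ ⌜ev X⌝ ⊛ aid Y).
Proof. by rewrite /ev_tens; pack. Qed.

Lemma arr_coev_tens X Y : ⌜coev_tens X Y⌝ = (aid X ⊛ ⌜coev Y⌝ ⊛ aid (X^∨)) • ⌜coev X⌝.
Proof. by rewrite /coev_tens; pack. Qed.

Lemma duality_ldual_tens X Y : duality (ev_tens X Y) (coev_tens X Y).
Proof.
exact: duality_tens (ldualP X) (ldualP Y) (arr_ev_tens X Y) (arr_coev_tens X Y).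
Qed.

Definition dual_tensV X Y : hom ((X ⊗ Y)^∨) (Y^∨ ⊗ X^∨) :=
  mate (coev_tens X Y) (ev (X ⊗ Y)) (idm (X ⊗ Y)).

Lemma ev_dual_tens X Y : ev (X ⊗ Y) ∘ (dual_tens X Y ⊠ idm _) = ev_tens X Y.
Proof. by rewrite mate_ev ?tensm_id ?compmI //; apply: ldualP. Qed.

Lemma ev_dual_tensV X Y : ev_tens X Y ∘ (dual_tensV X Y ⊠ idm _) = ev (X ⊗ Y).
Proof. by rewrite mate_ev ?tensm_id ?compmI //; apply: duality_ldual_tens. Qed.

Lemma dual_tensK X Y : dual_tensV X Y ∘ dual_tens X Y = idm _.
Proof.
apply: ev_inj (duality_ldual_tens X Y) _.
by rewrite tens_comp_idr compA ev_dual_tensV ev_dual_tens tensm_id compmI.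
Qed.

Lemma dual_tensVK X Y : dual_tens X Y ∘ dual_tensV X Y = idm _.
Proof.
apply: ev_inj (ldualP (X ⊗ Y)) _.
by rewrite tens_comp_idr compA ev_dual_tens ev_dual_tensV tensm_id compmI.
Qed.

Lemma coev_dual_tens X Y : (idm _ ⊠ dual_tens X Y) ∘ coev_tens X Y = coev (X ⊗ Y).
Proof.
by rewrite (mate_coev _ _ (duality_ldual_tens X Y)) tensm_id compIm.
Qed.

Lemma arr_ev_dual_tens X Y : ⌜ev (X ⊗ Y)⌝ • (⌜dual_tens X Y⌝ ⊛ aid (X ⊗ Y)) =
  ⌜ev Y⌝ • (aid (Y^∨) ⊛ ⌜ev X⌝ ⊛ aid Y).
Proof. by rewrite -arr_ev_tens -ev_dual_tens; pack. Qed.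

(** Paired with [X ⊗ Y ⊗ W], both sides become the same three nested evaluations. *)
Lemma dual_tensA X Y W :
  ⌜dual_tens (X ⊗ Y) W⌝ • (aid (W^∨) ⊛ ⌜dual_tens X Y⌝) =
  ⌜dual_tens X (Y ⊗ W)⌝ • (⌜dual_tens Y W⌝ ⊛ aid (X^∨)).
Proof.
suff: eqm (congr1 (@ldual k C) (tensA X Y W)) ∘
   (dual_tens (X ⊗ Y) W ∘ (idm (W^∨) ⊠ dual_tens X Y)) =
   dual_tens X (Y ⊗ W) ∘ (dual_tens Y W ⊠ idm (X^∨)) ∘ eqm (esym (tensA _ _ _)).
  by move/(congr1 Arr); pack.
apply: ev_inj (ldualP (X ⊗ Y ⊗ W)) _; pack.
rewrite !acomp_whiskerr // !acompA.
rewrite -[in LHS](tensA X Y W) arr_ev_dual_tens [in RHS]arr_ev_dual_tens.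
transitivity (⌜ev W⌝ • (aid (W^∨) ⊛ ⌜ev Y⌝ ⊛ aid W)
    • (aid (W^∨) ⊛ aid (Y^∨) ⊛ ⌜ev X⌝ ⊛ aid Y ⊛ aid W)).
  rewrite -(atens_id (X ⊗ Y)) !atensA -!acompA -!acomp_whiskerl //.
  rewrite -(atensA _ _ (aid W)) -!acomp_whiskerr // arr_ev_dual_tens.
  by rewrite acomp_whiskerr // !atensA.
rewrite [in RHS]atensA [in RHS]atens_id -[in RHS]acompA [in RHS]atens_rl //.
rewrite -(atens_lr ⌜dual_tens Y W⌝ _ (Y ⊗ W) (W^∨ ⊗ Y^∨)) // acompA arr_ev_dual_tens.
by rewrite -!atens_id !atensA.
Qed.

Context (j : pivotal C).

(** Naturality of the pivotal structure replaces [f] by its double transpose, which then passes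
    across [ev]. *)
Lemma tev_dualm X Y (f : hom X Y) :
  tev j X ∘ (idm X ⊠ dualm f) = tev j Y ∘ (f ⊠ idm (Y^∨)).
Proof.
rewrite /tev -compA tens_lr -[RHS]compA -tens_comp_idr piv_nat tens_comp_idr.
by rewrite [RHS]compA ev_dualm -compA tens_rl.
Qed.

(** Monoidality of the pivotal structure enters here. *)
Lemma tev_tens X Y :
  ⌜tev j (X ⊗ Y)⌝ • (aid (X ⊗ Y) ⊛ ⌜dual_tens X Y⌝) =
  ⌜tev j X⌝ • (aid X ⊛ ⌜tev j Y⌝ ⊛ aid (X^∨)).
Proof.
have -> : ⌜tev j (X ⊗ Y)⌝ • (aid (X ⊗ Y) ⊛ ⌜dual_tens X Y⌝) =
    ⌜ev_tens (Y^∨) (X^∨) ∘ ((piv j X ⊠ piv j Y) ⊠ idm _)⌝.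
  rewrite -ev_dual_tens -compA -tens_comp_idr -piv_tens tens_comp_idr compA.
  rewrite ev_dualm -compA tens_rl -tens_lr /tev !compA.
  by pack.
rewrite arr_comp arr_ev_tens /tev; pack.
rewrite -!acompA; congr (_ • _); rewrite atens_lr // -atens_id atensA -(atensA ⌜piv j Y⌝).
by rewrite atens_comp // aidl // acomp_whiskerr.
Qed.

End DualFunctor.

Section Scalars.
Context (k : fieldType) (C : fusionCat k).

Lemma scal_is_linear : scalar (@scal k C).
Proof. by move=> a f g; rewrite /scal linearP. Qed.
HB.instance Definition _ :=
  GRing.isLinear.Build k (hom (unit1 : C) unit1) k *%R (@scal k C) scal_is_linear.

Lemma scalZid (a : k) : scal (a *: idm (unit1 : C)) = a.
Proof.
have Fr : free [tuple idm (unit1 : C)] by rewrite [tval _]/= seq1_free; apply/eqP/fusion_unit_neq0.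
have E : scal (idm (unit1 : C)) = 1 := coord_free ord0 ord0 Fr.
by rewrite linearZ /= E mulr1.
Qed.

Lemma scalK (f : hom (unit1 : C) unit1) : scal f *: idm unit1 = f.
Proof. by have [c ->] := fusion_unit_scalar f; rewrite scalZid. Qed.

End Scalars.

(** * Pivotal traces *)

Section Trace.
Context (k : fieldType) (C : fusionCat k) (j : pivotal C).
Implicit Types X Y Z W Q : C.

Definition tr X (f : hom X X) : k := scal (tev j X ∘ (f ⊠ idm (X^∨)) ∘ coev X).

Lemma tr_is_linear X : scalar (@tr X).
Proof.
move=> a f g; rewrite /tr; have -> : (a *: f + g) ⊠ idm (X^∨) = a *: (f ⊠ idm _) + g ⊠ idm _.
  exact: linearP (tensl (idm (X^∨))) a f g.
by rewrite [tev j X ∘ _](linearP (postcomp (tev j X))) compDl compZl linearP.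
Qed.
HB.instance Definition _ X :=
  GRing.isLinear.Build k (hom X X) k *%R (@tr X) (@tr_is_linear X).

Lemma pdim_tr X : pdim j X = tr (idm X).
Proof. by rewrite /tr tensm_id compmI. Qed.

(** [f] travels around the loop, as its transpose on the dual strand. *)
Lemma trC X Y (f : hom X Y) (g : hom Y X) : tr (g ∘ f) = tr (f ∘ g).
Proof.
rewrite /tr; congr scal; move: (tev j X) (tev j Y) (tev_dualm j f) => tX tY E.
rewrite !tens_comp_idr -!compA coev_dualm [RHS]compA -E -[RHS]compA; congr (_ ∘ _).
by rewrite !compA tens_swap.
Qed.

Lemma pdim_iso X Y : isomorphic X Y -> pdim j X = pdim j Y.
Proof. by move=> [f [g [gf fg]]]; rewrite !pdim_tr -gf -fg trC. Qed.

Definition trm X (f : hom X X) := tev j X ∘ (f ⊠ idm (X^∨)) ∘ coev X.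

Lemma arr_tr_tens X Q (h : hom (X ⊗ Q) (X ⊗ Q)) :
  ⌜trm h⌝ = ⌜tev j X⌝ • (aid X ⊛ ⌜tev j Q⌝ ⊛ aid (X^∨)) • (⌜h⌝ ⊛ aid (Q^∨ ⊗ X^∨))
     • (aid X ⊛ ⌜coev Q⌝ ⊛ aid (X^∨)) • ⌜coev X⌝.
Proof.
rewrite /trm -coev_dual_tens compA -(compA (tev j _)) tens_lr -tens_rl compA; pack.
by rewrite arr_coev_tens tev_tens !acompA.
Qed.

(** The inner loop, over [Q], is a scalar and can be pulled out of the loop over [X]. *)
Lemma pdim_tens X Q : pdim j (X ⊗ Q) = pdim j X * pdim j Q.
Proof.
rewrite pdim_tr /tr -/(trm _).
suff -> : trm (idm (X ⊗ Q)) = pdim j Q *: (tev j X ∘ coev X) by rewrite linearZ /= mulrC.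
have -> : pdim j Q *: (tev j X ∘ coev X) =
   tev j X ∘ (idm X ⊠ (lun (X^∨) ∘ ((tev j Q ∘ coev Q) ⊠ idm (X^∨)) ∘ lunV (X^∨))) ∘ coev X.
  rewrite -(scalK (tev j Q ∘ coev Q)) tensZl tensm_id compZr compmI compZl.
  have -> : lun (X^∨) ∘ lunV (X^∨) = idm (X^∨) by pack.
  by rewrite tensZr tensm_id compZr compmI compZl.
apply: arr_inj; rewrite arr_tr_tens; pack.
by rewrite atens_id aidr // acomp_whiskerr // acomp_whiskerl // !acompA.
Qed.

(** Closing the strand of [Q] first turns [s] into a morphism [t] from [Y] to the unit object,
    through which the trace factors. *)
Lemma tr_eq0 X Y Q (b : hom X (X ⊗ Y)) (s : hom (Y ⊗ Q) Q) (h : hom (X ⊗ Q) (X ⊗ Q)) :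
  (forall t : hom Y unit1, t = 0) ->
  ⌜h⌝ = (aid X ⊛ ⌜s⌝) • (⌜b⌝ ⊛ aid Q) -> tr h = 0.
Proof.
move=> Y0 Eh; rewrite /tr -/(trm _).
pose t : hom Y unit1 :=
  tev j Q ∘ (s ⊠ idm _) ∘ ascV Y Q (Q^∨) ∘ (idm Y ⊠ coev Q) ∘ runV Y.
suff -> : trm h = tev j X ∘ (idm X ⊠ (lun (X^∨) ∘ (t ⊠ idm (X^∨)))) ∘ asc X Y (X^∨)
     ∘ (b ⊠ idm _) ∘ coev X.
  by rewrite (Y0 t) tens0m compm0 tensm0 compm0 !comp0m linear0.
apply: arr_inj; rewrite arr_tr_tens Eh /t; pack.
have key : ((⌜b⌝ ⊛ aid Q) ⊛ aid (Q^∨ ⊗ X^∨)) • (aid X ⊛ ⌜coev Q⌝ ⊛ aid (X^∨)) =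
    (aid X ⊛ aid Y ⊛ ⌜coev Q⌝ ⊛ aid (X^∨)) • (⌜b⌝ ⊛ aid (X^∨)).
  by rewrite atensA atens_id atens_lr // -[in RHS]atensA atens_id atens_rl.
rewrite (@acomp_whiskerr _ _ _ (aid X ⊛ ⌜s⌝)) // -!acompA; congr (_ • _).
rewrite (acompA _ _ ⌜coev X⌝) key !acompA; congr (_ • _ • _).
by rewrite !(acomp_whiskerl, acomp_whiskerr) // -!atens_id !atensA.
Qed.

End Trace.

(** * Schur's lemma and isotypic decompositions *)

Section Isomorphisms.
Context (k : fieldType) (C : linCat k).
Implicit Types X Y Z : C.

Lemma isomorphic_sym X Y : isomorphic X Y -> isomorphic Y X.
Proof. by move=> [f [g [gf fg]]]; exists g, f. Qed.

Lemma iso_mono X Y (f : hom X Y) : iso f -> mono f.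
Proof.
by move=> [g [gf _]] W a b E; rewrite -(compIm a) -(compIm b) -gf -!compA E.
Qed.

End Isomorphisms.

Section Eigenvector.
Import VectorInternalTheory.

Lemma lin_eigen (k : closedFieldType) (W : vectType k) (L : {linear W -> W}) (w : W) :
  w != 0 -> exists c : k, exists2 v, v != 0 & L v = c *: v.
Proof.
move=> w0; pose A := lin1_mx (v2r \o L \o r2v).
have d0 : (0 < dim W)%N.
  rewrite lt0n; apply: contraNneq w0 => d0; rewrite -(v2rK w).
  suff -> : v2r w = 0 by rewrite linear0.
  by apply/rowP => i; have := ltn_ord i; rewrite [X in (_ < X)%N]d0.
have /closed_rootP[c] : size (char_poly A) != 1%N.
  by rewrite size_char_poly eqSS -lt0n.
rewrite -eigenvalue_root_char => /eigenvalueP[v Ev v0].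
exists c, (r2v v); first by rewrite -(inj_eq (@v2r_inj _ W)) r2vK linear0.
apply: (@v2r_inj _ W); rewrite linearZ /= r2vK -Ev.
by rewrite /A mul_rV_lin1 /=.
Qed.

End Eigenvector.

Section Schur.
Context (k : closedFieldType) (C : fusionCat k).
Implicit Types S T X Y : C.

(** The kernel of [f] is a subobject of [S]: were it all of [S], [f] would vanish, so it is zero and
    [f] is mono. Simplicity of [T] concludes. *)
Lemma schur S T (f : hom S T) : simple S -> simple T -> f <> 0 -> iso f.
Proof.
move=> [_ simS] [_ simT] f0.
suff mono_f : mono f by case: (simT _ _ mono_f).
have [_ [/(_ _ _ f)[K [i [fi0 univ]]] _ _ _]] := fusion_abelian C.
have mono_i : mono i.
  move=> W g h E; have [|x [_ uni]] := univ _ (i ∘ g); first by rewrite compA fi0 comp0m.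
  by rewrite -(uni g) // -(uni h).
have i0 : i = 0.
  have [//|[g [_ ig]]] := simS _ _ mono_i.
  by case: f0; rewrite -(compmI f) -ig compA fi0 comp0m.
move=> W g h E; apply/subr0_eq.
have [|x [<- _]] := univ _ (g - h); last by rewrite i0 comp0m.
by rewrite compBr E subrr.
Qed.

(** Composition with [f] on the finite-dimensional space End(S) has an eigenvector; for its
    eigenvalue [c], the morphism [f - c *: idm S] annihilates it, hence is not invertible. *)
Lemma schur_end S (f : hom S S) : simple S -> exists c : k, f = c *: idm S.
Proof.
move=> simS; have [/eqP id0 _] := simS.
have [c [v v0 Ev]] := lin_eigen (postcomp f) id0.
exists c; apply/subr0_eq.
have [//|nz] := eqVneq (f - c *: idm S) 0.
have /iso_mono/(_ S v 0) := schur simS simS (elimN eqP nz).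
rewrite compBl compZl compIm compm0 [f ∘ v]Ev subrr => /(_ erefl) v_eq0.
by rewrite v_eq0 eqxx in v0.
Qed.

End Schur.

Section Isotypic.
Context (k : closedFieldType) (C : fusionCat k) (n : nat) (V : 'I_n -> C).
Hypothesis V_repr : simple_representatives V.
Implicit Types X Y : C.

(** A decomposition of [X] into simple objects, grouped by representative; orthogonality between
    different representatives follows from Schur's lemma. *)
Record isotypic X := Isotypic {
  iso_mult : 'I_n -> nat;
  iso_in : forall l, 'I_(iso_mult l) -> hom (V l) X;
  iso_out : forall l, 'I_(iso_mult l) -> hom X (V l);
  iso_outK : forall l a b, iso_out a ∘ iso_in b = (a == b)%:R *: idm (V l);
  iso_sum : \sum_l \sum_a iso_in a ∘ iso_out (l := l) a = idm X
}.

Arguments iso_in {X} i {l} a.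
Arguments iso_out {X} i {l} a.

Lemma simpleV l : simple (V l). Proof. by case: V_repr. Qed.

Lemma hom_simpleV l l' (f : hom (V l) (V l')) : l != l' -> f = 0.
Proof.
move=> /eqP ll'; have [//|/eqP f0] := eqVneq f 0; case: ll'.
have [_ inj _] := V_repr; apply: inj; exists f; apply: schur => //; exact: simpleV.
Qed.

Lemma isotypicP X : inhabited (isotypic X).
Proof.
have [n0 [S [simS [i [p [pi1 pi0 sum_ip]]]]]] := fusion_semisimple X.
have [_ _ V_all] := V_repr.
have [c isoS] : exists c : 'I_n0 -> 'I_n, forall a, isomorphic (S a) (V (c a)).
  apply: (@fin_all_exists _ (fun=> 'I_n) (fun a l => isomorphic (S a) (V l))) => a.
  exact: V_all.
pose D l := [set a | c a == l].
(* The last two equations say that the transported maps factor through one summand of the given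
   decomposition, from which they inherit orthogonality. *)
have H l (b : 'I_#|D l|) : {wz : hom (V l) X * hom X (V l) |
   [/\ wz.2 ∘ wz.1 = idm (V l), wz.1 ∘ wz.2 = i (enum_val b) ∘ p (enum_val b)
     & wz.2 = wz.2 ∘ i (enum_val b) ∘ p (enum_val b) /\
       wz.1 = i (enum_val b) ∘ p (enum_val b) ∘ wz.1]}.
  apply: constructive_indefinite_description.
  move: (enum_val b) (enum_valP b) => a; rewrite inE => /eqP <- {l b}.
  have [f [g [gf fg]]] := isoS a.
  exists (i a ∘ g, f ∘ p a) => /=; split.
  - by rewrite compA -(compA f) pi1 compmI.
  - by rewrite compA -(compA (i a)) gf compmI.
  split; first by rewrite -(compA f) pi1 compmI.
  by rewrite -!compA !(compA (p a)) pi1 compIm.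
constructor; exists (fun l => #|D l|) (fun l b => (sval (H l b)).1) (fun l b => (sval (H l b)).2).
  move=> l a b; case: (svalP (H l a)) (svalP (H l b)) => [zw _ [za _]] [_ _ [_ wb]].
  have [<-|ab] := eqVneq a b; first by rewrite scale1r.
  rewrite za wb scale0r -!compA (compA (p _) (i _)) pi0 ?comp0m ?compm0 //.
  by apply: contraNneq ab => /enum_val_inj->.
rewrite -sum_ip (partition_big c xpredT) //=; apply: eq_bigr => l _.
transitivity (\sum_(a in D l) i a ∘ p a); last by apply: eq_bigl => a; rewrite inE.
rewrite [RHS]big_enum_val; apply: eq_bigr => b _.
by case: (svalP (H l b)).
Qed.

Definition isotypic_of X : isotypic X := epsilon (isotypicP X) xpredT.

Section Data.
Context (X : C) (D : isotypic X).

Lemma iso_in_sum l (g : hom (V l) X) :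
  g = \sum_(a < iso_mult D l) iso_in D a ∘ (iso_out D a ∘ g).
Proof.
rewrite -{1}(compIm g) -(iso_sum D) comp_suml (bigD1 l) //= -[RHS]addr0; congr (_ + _).
  by rewrite comp_suml; apply: eq_bigr => a _; rewrite compA.
apply: big1 => l' ll'; rewrite comp_suml big1 // => a _.
by rewrite -compA [iso_out D a ∘ g]hom_simpleV ?compm0 // eq_sym.
Qed.

Lemma iso_out_sum l (h : hom X (V l)) :
  h = \sum_(a < iso_mult D l) h ∘ iso_in D a ∘ iso_out D a.
Proof.
rewrite -{1}(compmI h) -(iso_sum D) comp_sumr (bigD1 l) //= -[RHS]addr0; congr (_ + _).
  by rewrite comp_sumr; apply: eq_bigr => a _; rewrite compA.
apply: big1 => l' ll'; rewrite comp_sumr big1 // => a _.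
by rewrite compA [h ∘ iso_in D a]hom_simpleV ?comp0m.
Qed.

(** The inclusions are a basis of Hom(V l, X): projections read off coefficients, and Schur's lemma
    gives generation. *)
Lemma multiplicityE l : multiplicity V l X = iso_mult D l.
Proof.
pose B := [tuple iso_in D a | a < iso_mult D l].
have coef (c : 'I_(iso_mult D l) -> k) b :
    iso_out D b ∘ (\sum_a c a *: iso_in D a) = c b *: idm (V l).
  rewrite comp_sumr (bigD1 b) //= big1 => [|a ab].
    by rewrite addr0 compZr iso_outK eqxx scale1r.
  by rewrite compZr iso_outK eq_sym (negPf ab) scale0r scaler0.
have freeB : free B.
  apply/freeP => c E b; have := coef c b.
  have -> : \sum_a c a *: iso_in D a = 0.
    by rewrite -[RHS]E; apply: eq_bigr => a _; rewrite (nth_mktuple _ _ a).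
  rewrite compm0 => /esym/eqP; rewrite scaler_eq0 => /orP[/eqP//|/eqP].
  by have [] := simpleV l.
have spanB : (<<B>> = fullv)%VS.
  apply/eqP; rewrite eqEsubv subvf; apply/subvP => g _.
  rewrite (iso_in_sum g); apply: memv_suml => a _.
  have [c ->] := schur_end (iso_out D a ∘ g) (simpleV l).
  rewrite compZr compmI memvZ // memv_span //.
  by apply/tnthP; exists a; rewrite tnth_mktuple.
by rewrite /multiplicity -spanB (eqnP freeB) size_tuple.
Qed.

End Data.
End Isotypic.

Arguments iso_in {k C n V X} i {l} a.
Arguments iso_out {k C n V X} i {l} a.
Arguments iso_mult {k C n V X}.

(** * The adjoint object *)

Section AdjointObject.
Context (k : fieldType) (C : fusionCat k) (Z : central_comonad C) (j : pivotal C).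
Implicit Types X Y W : C.

Local Notation A := (adj Z).
Local Notation pi := (pi1 Z).

Lemma arr_pi1 X : ⌜pi X⌝ = ⌜Zpi Z unit1 X⌝.
Proof. by rewrite /pi1; pack; rewrite atens_id aidl. Qed.

Lemma pi1_dinat X Y (f : hom X Y) :
  (f ⊠ idm (X^∨)) ∘ pi X = (idm Y ⊠ dualm f) ∘ pi Y.
Proof.
have [/(_ _ _ f) D _] := Zpi_end Z unit1; apply: arr_inj; move/(congr1 Arr): D; pack.
by rewrite !arr_pi1 !atens1l.
Qed.

Lemma end_inj W (h h' : hom W A) : (forall X, pi X ∘ h = pi X ∘ h') -> h = h'.
Proof.
move=> E; have [D /(_ W (fun X => Zpi Z unit1 X ∘ h'))[|x [_ U]]] := Zpi_end Z unit1.
  by move=> X Y f; rewrite !compA D.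
rewrite -(U h) ?(U h') // => X; apply: arr_inj; move/(congr1 Arr): (E X); pack.
by rewrite arr_pi1.
Qed.

Lemma end_ex W (g : forall X, hom W (X ⊗ X^∨)) :
  (forall X Y (f : hom X Y), (f ⊠ idm _) ∘ g X = (idm _ ⊠ dualm f) ∘ g Y) ->
  exists h : hom W A, forall X, pi X ∘ h = g X.
Proof.
move=> D; have [_ /(_ W (fun X => (idm X ⊠ lunV (X^∨)) ∘ g X))[|h [E _]]] := Zpi_end Z unit1.
  move=> X Y f; apply: arr_inj; move/(congr1 Arr): (D X Y f); pack.
  by rewrite !atens1l !atens_id !aidl.
exists h => X; rewrite /pi1 -compA E; pack.
by rewrite !atens_id !aidl.
Qed.

Lemma pi1_tilde f X : pi X ∘ tilde f =
  (idm X ⊠ (lun (X^∨) ∘ (f ⊠ idm (X^∨)))) ∘ (Zpi Z A X ∘ Zdelta Z unit1).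
Proof. by rewrite /pi1 /tilde tens_comp_idl -!compA (compA (Zpi Z _ X)) ZmapE !compA. Qed.

Lemma tilde_is_linear : linear (@tilde k C Z).
Proof.
move=> a f g; apply: end_inj => X.
rewrite compDr compZr !pi1_tilde -compZl -compDl; congr (_ ∘ _).
rewrite -tensZr -tensDr -compZr -compDr; congr (_ ⊠ (_ ∘ _)).
by rewrite -tensZl -tensDl.
Qed.
HB.instance Definition _ :=
  GRing.isLinear.Build k (hom A unit1) (hom A A) *:%R (@tilde k C Z) tilde_is_linear.

(* The partial pivotal trace over [Y], with [(X ⊗ Y)^∨] read as
   [Y^∨ ⊗ X^∨]. *)
Definition kappa X Y : hom ((X ⊗ Y) ⊗ (X ⊗ Y)^∨) (X ⊗ X^∨) :=
  (idm X ⊠ (lun (X^∨) ∘ (tev j Y ⊠ idm (X^∨)))) ∘ eqm (tens22A X Y (Y^∨) (X^∨))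
    ∘ (idm (X ⊗ Y) ⊠ dual_tensV X Y).

Lemma arr_kappa X Y :
  ⌜kappa X Y⌝ = (aid X ⊛ ⌜tev j Y⌝ ⊛ aid (X^∨)) • (aid (X ⊗ Y) ⊛ ⌜dual_tensV X Y⌝).
Proof. by rewrite /kappa; pack. Qed.

Lemma kappa_dual_tens X Y :
  ⌜kappa X Y⌝ • (aid (X ⊗ Y) ⊛ ⌜dual_tens X Y⌝) = aid X ⊛ ⌜tev j Y⌝ ⊛ aid (X^∨).
Proof.
rewrite arr_kappa -acompA -acomp_whiskerl // -arr_comp dual_tensK; pack.
by rewrite atens_id aidr.
Qed.

Lemma dual_tens_cancel X Y (F G : arr C) : dom F = (X ⊗ Y) ⊗ (X ⊗ Y)^∨ -> dom G = dom F ->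
  F • (aid (X ⊗ Y) ⊛ ⌜dual_tens X Y⌝) = G • (aid (X ⊗ Y) ⊛ ⌜dual_tens X Y⌝) -> F = G.
Proof.
have K H : dom H = (X ⊗ Y) ⊗ (X ⊗ Y)^∨ ->
    H • (aid (X ⊗ Y) ⊛ ⌜dual_tens X Y⌝) • (aid (X ⊗ Y) ⊛ ⌜dual_tensV X Y⌝) = H.
  move=> dH; rewrite -acompA -acomp_whiskerl // -arr_comp dual_tensVK; pack.
  by rewrite atens_id aidr.
by move=> dF dG E; rewrite -(K F) // E K // dG.
Qed.

(** The equation defining the comultiplication turns the iterated component into the one at [X ⊗ Y];
    the character then closes the strand of [Y]. *)
Lemma pi1_tilde_ch X Y : pi X ∘ tilde (ch Z j Y) = kappa X Y ∘ pi (X ⊗ Y).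
Proof.
rewrite pi1_tilde; apply: arr_inj; rewrite [in RHS]arr_comp arr_pi1 -ZdeltaE /ch; pack.
rewrite atens1l arr_pi1 !acompA kappa_dual_tens acomp_whiskerr // acomp_whiskerl //.
Qed.

(** As [f ∘ tilde g] is the product f ⋆ g, this is multiplicativity of characters. *)
Lemma ch_tilde_ch X Y : ch Z j X ∘ tilde (ch Z j Y) = ch Z j (X ⊗ Y).
Proof.
have E : tev j X ∘ kappa X Y = tev j (X ⊗ Y).
  apply: arr_inj; apply: (@dual_tens_cancel X Y) => //; pack.
  by rewrite tev_tens -acompA kappa_dual_tens.
by rewrite /ch -compA pi1_tilde_ch compA E.
Qed.

(** Once the invertible comparison maps are removed, this amounts to [tev_tens]. *)
Lemma kappaA X Y W : ⌜kappa X Y⌝ • ⌜kappa (X ⊗ Y) W⌝ = ⌜kappa X (Y ⊗ W)⌝.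
Proof.
apply: (@dual_tens_cancel (X ⊗ Y) W) => //.
rewrite -acompA kappa_dual_tens.
have K H : dom H = (X ⊗ Y ⊗ W) ⊗ (W^∨ ⊗ (X ⊗ Y)^∨) ->
    H • (aid (X ⊗ Y ⊗ W) ⊛ aid (W^∨) ⊛ ⌜dual_tens X Y⌝)
      • (aid (X ⊗ Y ⊗ W) ⊛ aid (W^∨) ⊛ ⌜dual_tensV X Y⌝) = H.
  move=> dH; rewrite -acompA -!acomp_whiskerl // -arr_comp dual_tensVK; pack.
  by rewrite !atens_id aidr.
rewrite -[LHS]K // -[RHS]K //; congr (_ • _).
have -> : aid ((X ⊗ Y) ⊗ W) = aid (X ⊗ Y ⊗ W) by rewrite tensA.
rewrite -[RHS]acompA -acomp_whiskerl // dual_tensA acomp_whiskerl // acompA kappa_dual_tens.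
have L : (aid (X ⊗ Y) ⊛ ⌜tev j W⌝ ⊛ aid ((X ⊗ Y)^∨)) •
      (aid (X ⊗ Y ⊗ W) ⊛ aid (W^∨) ⊛ ⌜dual_tens X Y⌝) =
    (aid (X ⊗ Y) ⊛ ⌜dual_tens X Y⌝) • (aid (X ⊗ Y) ⊛ ⌜tev j W⌝ ⊛ aid (Y^∨ ⊗ X^∨)).
  have -> : aid (X ⊗ Y ⊗ W) = aid (X ⊗ Y) ⊛ aid W by rewrite atens_id tensA.
  rewrite atensA -!acomp_whiskerl //; congr (_ ⊛ _).
  by rewrite -atensA atens_id atens_lr // (evl ⌜tev j W⌝).
rewrite -acompA L acompA kappa_dual_tens.
rewrite -(atens_id X (Y ⊗ W)) atensA -!acomp_whiskerl // -(atensA (aid (Y ⊗ W))).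
rewrite -acomp_whiskerr // tev_tens acomp_whiskerr // !acomp_whiskerl //.
by rewrite -!atens_id !atensA.
Qed.

Lemma tilde_ch_comp Y W :
  tilde (ch Z j Y) ∘ tilde (ch Z j W) = tilde (ch Z j (Y ⊗ W)).
Proof.
apply: end_inj => X; rewrite compA !pi1_tilde_ch -compA pi1_tilde_ch.
apply: arr_inj; pack; rewrite acompA kappaA.
by congr (_ • _); rewrite (tensA X Y W).
Qed.

(** By dinaturality [p] moves around the loop and meets [i]. Summed over a decomposition of [X],
    this gives additivity of characters. *)
Lemma ch_retract X S (i : hom S X) (p : hom X S) :
  p ∘ i = idm S -> tev j X ∘ ((i ∘ p) ⊠ idm (X^∨)) ∘ pi X = ch Z j S.
Proof.
move=> pi1; rewrite /ch; move: (tev j X) (tev j S) (tev_dualm j p) => tX tS E.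
move: (pi X) (pi S) (pi1_dinat p) => pX pS D.
rewrite tens_comp_idr compA -compA D compA -(compA tX) tens_swap compA E.
by rewrite -(compA tS) -tens_comp_idr pi1 tensm_id compmI.
Qed.

Lemma ch_iso X Y : isomorphic X Y -> ch Z j X = ch Z j Y.
Proof.
by move=> [f [g [gf fg]]]; rewrite -(ch_retract fg) gf tensm_id compmI.
Qed.

Lemma pi1_psi (a : CE Z) X : pi X ∘ a = (psi a X ⊠ idm (X^∨)) ∘ coev X.
Proof.
apply: arr_inj; rewrite /psi /adj_act; move: (pi X) => pX; pack.
rewrite !acomp_whiskerr // !atensA atens_id -!acompA (coevl ⌜a⌝) // -(coevr ⌜coev X⌝ ⌜a⌝ A) //.
rewrite (acompA (⌜pX⌝ ⊛ _)) atens_lr //  -(coevr ⌜coev X⌝ ⌜pX⌝ (X ⊗ X^∨)) // -atens_id !acompA.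
by rewrite atensA -acomp_whiskerl // duality_zag ?atens_id ?aidl //; apply: ldualP.
Qed.

Lemma psi_nat (a : CE Z) X Y (f : hom X Y) : f ∘ psi a X = psi a Y ∘ f.
Proof.
apply: arr_inj; have /(congr1 Arr) := ev_dualm f; pack => E.
rewrite /psi /adj_act; move: (pi X) (pi Y) (pi1_dinat f) => pX pY /(congr1 Arr); pack => D.
rewrite !acompA (evr ⌜ev X⌝) // -(atens_rl _ _ Y (X^∨ ⊗ X)) // -atens_id -(atensA ⌜f⌝).
rewrite -(acompA _ _ (⌜pX⌝ ⊛ _)) -acomp_whiskerr // D acomp_whiskerr // acompA atensA.
rewrite -acomp_whiskerl // E acomp_whiskerl // -!acompA; congr (_ • _).
rewrite !acompA -atensA atens_id atens_rl // -!acompA (coevl ⌜a⌝) //.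
by rewrite -(atens_rl ⌜a⌝ ⌜f⌝ A X) // acompA atens_lr.
Qed.

Lemma psi_mul (M : adjoint_algebra Z) (a : CE Z) X :
  pi X ∘ (adj_mul M ∘ (a ⊠ idm A) ∘ lunV A) = (psi a X ⊠ idm (X^∨)) ∘ pi X.
Proof.
rewrite /psi /adj_act; move: (pi X) (adj_mulE M X) => pX E.
rewrite !compA E; apply: arr_inj; pack.
rewrite -(atens_lr ⌜pX⌝ ⌜pX⌝ (X ⊗ X^∨) A) // -!acompA atens_rl //.
rewrite -(coevl ⌜a⌝ ⌜pX⌝ (X ⊗ X^∨)) // -!atens_id !acompA; congr (_ • _).
by rewrite !acomp_whiskerr // !atensA.
Qed.

(** The antipode is specified through right duals; [phi] compares [X] with the right dual of [X^∨],
    and [psi a] is natural along it. *)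
Lemma psi_antipode (M : adjoint_algebra Z) (a : CE Z) X :
  psi (antipode M a) (X^∨) = dualm (psi a X).
Proof.
rewrite antipodeE /bang; set Y := rdual (X^∨).
pose e := rev (X^∨); pose c := rcoev (X^∨).
pose phi : hom X Y := run Y ∘ (idm Y ⊠ ev X) ∘ asc Y (X^∨) X ∘ (c ⊠ idm X) ∘ lunV X.
have D : duality e c := rdualP (X^∨).
have Ephi : e ∘ (idm (X^∨) ⊠ phi) = ev X.
  apply: arr_inj; rewrite /phi; pack.
  rewrite acomp_whiskerl // acompA -(atensA (aid (X^∨))) atens_id (evr ⌜ev X⌝) //.
  rewrite -(evl ⌜e⌝ ⌜ev X⌝ (X^∨ ⊗ X)) // -atens_id -acompA -!atensA -acomp_whiskerr //.
  by rewrite (duality_zag D) atens_id aidr.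
apply: ev_inj (ldualP X) _; rewrite ev_dualm -Ephi -!compA -tens_swap.
by rewrite compA mate_ev // -compA -!tens_comp_idl psi_nat.
Qed.

End AdjointObject.

(** * Bending of morphisms and the dual of the unit object *)

Section MoreDuality.
Context (k : fieldType) (C : fusionCat k).
Implicit Types X Y W : C.

Lemma dualm_is_linear X Y : linear (@dualm k C X Y).
Proof.
move=> a f g; apply: ev_inj (ldualP X) _; rewrite ev_dualm.
by rewrite tensDr tensDl tensZr tensZl !compDr !compZr !ev_dualm.
Qed.
HB.instance Definition _ X Y :=
  GRing.isLinear.Build k (hom X Y) (hom (Y^∨) (X^∨)) *:%R (@dualm k C X Y)
    (@dualm_is_linear X Y).

Lemma ev_surj W X (g : hom (W ⊗ X) unit1) : exists a : hom W (X^∨), g = ev X ∘ (a ⊠ idm X).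
Proof.
exists (lun (X^∨) ∘ (g ⊠ idm (X^∨)) ∘ ascV W X (X^∨) ∘ (idm W ⊠ coev X) ∘ runV W).
apply: arr_inj; pack.
rewrite acomp_whiskerr // acompA atensA atens_id (evl ⌜g⌝) // -(evr ⌜ev X⌝ ⌜g⌝ (W ⊗ X)) //.
rewrite -atens_id !atensA -acompA -acomp_whiskerl //.
by rewrite (duality_zig (ldualP X)) atens_id aidr.
Qed.

Lemma coev_surj W X (g : hom unit1 (W ⊗ X^∨)) :
  exists a : hom X W, g = (a ⊠ idm (X^∨)) ∘ coev X.
Proof.
exists (run W ∘ (idm W ⊠ ev X) ∘ asc W (X^∨) X ∘ (g ⊠ idm X) ∘ lunV X).
apply: arr_inj; pack.
rewrite acomp_whiskerr // -acompA atensA (atensA ⌜g⌝) atens_id (coevl ⌜g⌝) //.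
rewrite -(coevr ⌜coev X⌝ ⌜g⌝ (W ⊗ X^∨)) // -atens_id atensA acompA -acomp_whiskerl //.
by rewrite (duality_zag (ldualP X)) atens_id aidl.
Qed.

Lemma coev_unit : ⌜coev (unit1 : C)⌝ • ⌜ev unit1⌝ = aid (unit1^∨).
Proof.
rewrite coev_ev' // -(duality_zag (ldualP (unit1 : C))) atens_lr //.
Qed.

Context (j : pivotal C).

Lemma pdim_unit_idem : pdim j unit1 * pdim j unit1 = pdim j unit1.
Proof. by rewrite -pdim_tens tens1o. Qed.

(** At the unit object [coev] after [ev] is the identity, so [tev] is determined by its composite
    with [coev], the dimension. *)
Lemma tev_unit : tev j unit1 = pdim j unit1 *:
   (ev (unit1 : C) ∘ eqm (etrans (tens1o (unit1^∨)) (esym (tenso1 (unit1^∨))))).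
Proof.
rewrite /pdim; move: (tev j unit1) => t; rewrite -[X in _ *: X]compIm -compZl scalK.
by apply: arr_inj; pack; rewrite -acompA coev_unit aidr //.
Qed.

Lemma dual_tens_unit X : ⌜dual_tens X unit1⌝ = ⌜ev (unit1 : C)⌝ ⊛ aid (X^∨).
Proof.
suff : eqm (congr1 (@ldual k C) (tenso1 X)) ∘ dual_tens X unit1 =
   lun (X^∨) ∘ (ev (unit1 : C) ⊠ idm (X^∨)) ∘ ascV (unit1^∨) unit1 (X^∨)
     ∘ (idm (unit1^∨) ⊠ lunV (X^∨)).
  by move/(congr1 Arr); pack => ->; rewrite atens_id aidr.
apply: ev_inj (ldualP X) _; apply: arr_inj; pack; rewrite atens_id aidr //.
have := arr_ev_dual_tens X unit1.
have -> : ⌜ev (X ⊗ unit1)⌝ = ⌜ev X⌝ by rewrite tenso1.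
have -> : aid (X ⊗ unit1) = aid X by rewrite tenso1.
move=> ->; rewrite atens1r atensA atens_id.
by rewrite (evl ⌜ev unit1⌝) // (evr ⌜ev X⌝ ⌜ev unit1⌝).
Qed.

Lemma kappa_unit X : exists p, kappa j X unit1 = pdim j unit1 *: eqm p.
Proof.
have p : (X ⊗ unit1) ⊗ (X ⊗ unit1)^∨ = X ⊗ X^∨ by rewrite tenso1.
exists p.
suff E : kappa j X unit1 ∘ (idm (X ⊗ unit1) ⊠ dual_tens X unit1) =
    (pdim j unit1 *: eqm p) ∘ (idm (X ⊗ unit1) ⊠ dual_tens X unit1).
  by apply: arr_inj; apply: (@dual_tens_cancel _ _ X unit1) => //; rewrite -arr_id -arr_tens -!arr_comp E.
set r := eqm p ∘ (idm (X ⊗ unit1) ⊠ dual_tens X unit1).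
rewrite compZl -/r.
have -> : r = (idm X ⊠ (lun (X^∨) ∘
    ((ev (unit1 : C) ∘ eqm (etrans (tens1o (unit1^∨)) (esym (tenso1 (unit1^∨))))) ⊠ idm (X^∨))))
      ∘ eqm (tens22A X unit1 (unit1^∨) (X^∨)).
  apply: arr_inj; rewrite /r; pack.
  by rewrite dual_tens_unit tenso1.
rewrite -compZl -tensZr -compZr -tensZl -tev_unit.
by apply: arr_inj; pack; rewrite kappa_dual_tens.
Qed.

Lemma tilde_ch_unit (Z : central_comonad C) :
  tilde (ch Z j unit1) = pdim j unit1 *: idm (adj Z).
Proof.
apply: end_inj => X; rewrite pi1_tilde_ch compZr compmI.
have [p ->] := kappa_unit X; rewrite compZl; congr (_ *: _).
by apply: arr_inj; pack; rewrite tenso1.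
Qed.

End MoreDuality.

(** * Dimensions of simple objects *)

Section SimpleDimension.
Context (k : closedFieldType) (C : fusionCat k) (j : pivotal C).
Context (n : nat) (V : 'I_n -> C) (V_repr : simple_representatives V).
Implicit Types S T X Y W : C.

(** Duality and the pivotal structure identify Hom(S ⊗ S^∨, 1) with End(S), to which Schur's lemma
    applies. *)
Lemma tev_span S (g : hom (S ⊗ S^∨) unit1) : simple S -> exists c, g = c *: tev j S.
Proof.
move=> simS; have [a ->] := ev_surj g; have [b [bj jb]] := piv_iso j S.
have [c Ec] := schur_end (b ∘ a) simS; exists c.
by rewrite -(compIm a) -jb -compA Ec compZr compmI tensZl compZr.
Qed.

Lemma coev_neq0 X : idm X <> 0 -> coev X <> 0.
Proof.
move=> id0 c0; apply: id0; apply: coev_injl (ldualP X) _.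
by rewrite c0 !compm0.
Qed.

(** As [coev S] is nonzero, some projection onto a simple summand does not kill it, and Schur's
    lemma makes this a retraction of [coev S]. The retraction is a multiple of [tev j S], so
    [tev j S ∘ coev S] cannot vanish. *)
Lemma pdim_simple_neq0 S : simple (unit1 : C) -> simple S -> pdim j S != 0.
Proof.
move=> sim1 simS; have [id0 _] := simS.
suff [r Er] : exists r : hom (S ⊗ S^∨) unit1, r ∘ coev S = idm unit1.
  have [c Ec] := tev_span r simS; apply/eqP => d0.
  have [] := sim1; case; rewrite -Er Ec compZl -[_ ∘ _]scalK -/(pdim j S).
  by rewrite d0 scale0r scaler0.
pose D := isotypic_of V_repr (S ⊗ S^∨).
have [/forallP/(_ _)/forallP all0|] := boolP [forall l, [forall a, iso_out D (l := l) a ∘ coev S == 0]].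
  case: (coev_neq0 id0); rewrite -[coev S]compIm -(iso_sum D) comp_suml big1 // => l _.
  rewrite comp_suml big1 // => a _; rewrite -compA.
  by have /eqP -> := all0 l a; rewrite compm0.
rewrite negb_forall => /existsP[l]; rewrite negb_forall => /existsP[a /eqP nz].
have [r [Er _]] := schur sim1 (simpleV V_repr l) nz.
by exists (r ∘ iso_out D a); rewrite -compA.
Qed.

(** By duality Hom(1, S ⊗ T^∨) is Hom(T, S). *)
Lemma dim_hom_unit S T : simple S -> simple T ->
  (isomorphic S T -> \dim {: hom unit1 (S ⊗ T^∨)} = 1%N) /\
  (~ isomorphic S T -> \dim {: hom unit1 (S ⊗ T^∨)} = 0%N).
Proof.
move=> simS simT; split => ST.
  have [f [g [gf fg]]] := ST; have [id0 _] := simT.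
  have -> : fullv = <[(g ⊠ idm (T^∨)) ∘ coev T]>%VS.
    apply/eqP; rewrite eqEsubv subvf andbT; apply/subvP => h _; apply/vlineP.
    have [a ->] := coev_surj h; have [c Ec] := schur_end (f ∘ a) simT; exists c.
    by rewrite -(compIm a) -gf -compA Ec compZr compmI tensZl compZl.
  rewrite dim_vline; case: eqP => // E; case: id0.
  apply: coev_injl (ldualP T) _; rewrite tens0m comp0m.
  by rewrite -fg tens_comp_idr -compA E compm0.
suff -> : fullv = 0%VS :> {vspace hom unit1 (S ⊗ T^∨)} by rewrite dimv0.
apply/eqP; rewrite eqEsubv sub0v andbT; apply/subvP => h _; rewrite memv0.
have [a ->] := coev_surj h; have [->|/eqP a0] := eqVneq a 0; first by rewrite tens0m comp0m.
by case: ST; apply: isomorphic_sym; exists a; apply: schur.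
Qed.

End SimpleDimension.

(** * The adjoint object as the sum of the [V l ⊗ (V l)^∨] *)

Section AdjointDecomposition.
Context (k : closedFieldType) (C : fusionCat k) (Z : central_comonad C) (j : pivotal C).
Context (n : nat) (V : 'I_n -> C) (V_repr : simple_representatives V).
Hypothesis unit_simple : simple (unit1 : C).
Implicit Types S T X Y W : C.

Local Notation A := (adj Z).
Local Notation pi := (pi1 Z).
Local Notation D := (isotypic_of V_repr).

Lemma ch_mult X : ch Z j X = \sum_l (multiplicity V l X)%:R *: ch Z j (V l).
Proof.
rewrite {1}/ch -[pi X]compIm -tensm_id -(iso_sum (D X)) tens_suml comp_suml comp_sumr.
apply: eq_bigr => l _; rewrite tens_suml comp_suml comp_sumr.
rewrite (multiplicityE V_repr (D X)) scaler_nat -[X in _ *+ X]card_ord -sumr_const.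
apply: eq_bigr => a _; rewrite compA ch_retract //.
by rewrite iso_outK eqxx scale1r.
Qed.

(* The component at [X] of the inclusion of the summand [V l ⊗ (V l)^∨]
   of the adjoint object. *)
Definition theta l X : hom (V l ⊗ (V l)^∨) (X ⊗ X^∨) :=
  \sum_a iso_in (D X) a ⊠ dualm (iso_out (D X) (l := l) a).

(** Expanding [f] between the two decompositions leaves endomorphisms of [V l], which are scalars
    and move freely between the tensor factors. *)
Lemma theta_dinat l X Y (f : hom X Y) :
  (f ⊠ idm _) ∘ theta l X = (idm _ ⊠ dualm f) ∘ theta l Y.
Proof.
rewrite /theta !comp_sumr.
transitivity (\sum_(a < iso_mult (D X) l) \sum_(b < iso_mult (D Y) l)
    (iso_in (D Y) b ∘ (iso_out (D Y) b ∘ (f ∘ iso_in (D X) a)))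
      ⊠ dualm (iso_out (D X) (l := l) a)).
  apply: eq_bigr => a _; rewrite -tens_suml -(iso_in_sum V_repr).
  by rewrite -tensm_comp compIm.
rewrite exchange_big; apply: eq_bigr => b _ /=.
transitivity (iso_in (D Y) b ⊠ dualm (iso_out (D Y) b ∘ f)); last first.
  by rewrite dualm_comp -tensm_comp compIm.
rewrite (iso_out_sum V_repr (D X) (iso_out (D Y) b ∘ f)) linear_sum tens_sumr.
apply: eq_bigr => a _; rewrite -(compA _ f (iso_in _ a)).
have [c ->] := schur_end (iso_out (D Y) b ∘ (f ∘ iso_in (D X) a)) (simpleV V_repr l).
by rewrite compZr compmI compZl compIm linearZ /= tensZl tensZr.
Qed.

Lemma theta_neq l l' : l != l' -> theta l (V l') = 0.
Proof.
move=> ll'; rewrite /theta big1 // => a _.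
by rewrite [iso_in _ a](hom_simpleV V_repr) // tens0m.
Qed.

Lemma theta_refl l : theta l (V l) = idm _.
Proof.
have E (h : hom (V l) (V l)) : exists c, h = c *: idm (V l).
  exact: schur_end (simpleV V_repr l).
transitivity ((\sum_a iso_in (D (V l)) (l := l) a ∘ iso_out (D (V l)) a) ⊠ idm ((V l)^∨)).
  rewrite tens_suml; apply: eq_bigr => a _.
  have [c ->] := E (iso_out (D (V l)) a); have [d ->] := E (iso_in (D (V l)) a).
  by rewrite linearZ /= dualm_id compZr compmI tensZr !tensZl.
suff -> : \sum_a iso_in (D (V l)) (l := l) a ∘ iso_out (D (V l)) a = idm _.
  by rewrite tensm_id.
rewrite -[RHS](iso_sum (D (V l))) (bigD1 l) //= -[LHS]addr0; congr (_ + _).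
rewrite big1 // => l' ll'; rewrite big1 // => a _.
by rewrite [iso_in _ a](hom_simpleV V_repr) // comp0m.
Qed.

Lemma iota_ex l : exists h : hom (V l ⊗ (V l)^∨) A, forall X, pi X ∘ h = theta l X.
Proof. by apply: end_ex => X Y f; apply: theta_dinat. Qed.

Definition iota l : hom (V l ⊗ (V l)^∨) A :=
  sval (constructive_indefinite_description _ (iota_ex l)).

Lemma pi1_iota l X : pi X ∘ iota l = theta l X.
Proof. by rewrite /iota; case: constructive_indefinite_description. Qed.

(** Dinaturality brings the projections to the first factor, where they compose with the inclusions
    to the identity of [X]. *)
Lemma iota_sum : \sum_l iota l ∘ pi (V l) = idm A.
Proof.
apply: end_inj => X; rewrite comp_sumr compmI.
transitivity ((\sum_l \sum_a iso_in (D X) (l := l) a ∘ iso_out (D X) a) ⊠ idm (X^∨) ∘ pi X).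
  rewrite tens_suml comp_suml; apply: eq_bigr => l _.
  rewrite compA pi1_iota tens_suml !comp_suml; apply: eq_bigr => a _.
  by rewrite -tens_lr -compA -pi1_dinat compA -tens_comp_idr.
by rewrite iso_sum tensm_id compIm.
Qed.

Lemma CF_span (f : CF Z) : exists x : 'I_n -> k, f = \sum_l x l *: ch Z j (V l).
Proof.
have H l : exists c, f ∘ iota l = c *: tev j (V l).
  exact: tev_span (simpleV V_repr l).
have [x Hx] : exists x : 'I_n -> k, forall l, f ∘ iota l = x l *: tev j (V l).
  exact: (@fin_all_exists _ (fun=> k) (fun l c => f ∘ iota l = c *: tev j (V l))) H.
exists x; rewrite -[f]compmI -iota_sum comp_sumr; apply: eq_bigr => l _.
by rewrite compA Hx compZl.
Qed.

(** Cyclicity distributes the trace over the summands [V l ⊗ (V l)^∨], where each term has the shape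
    treated by [tr_eq0]. *)
Lemma tr_tilde_ch_eq0 Y : (forall t : hom Y unit1, t = 0) -> tr j (tilde (ch Z j Y)) = 0.
Proof.
move=> Y0; rewrite -(compmI (tilde _)) -iota_sum comp_sumr linear_sum big1 // => l _.
rewrite /= compA trC compA pi1_tilde_ch -compA pi1_iota /theta comp_sumr linear_sum big1 // => a _ /=.
set X := V l; set b := iso_in _ a; set c := dualm _.
pose s : hom (Y ⊗ X^∨) (X^∨) :=
  lun (X^∨) ∘ (tev j Y ⊠ idm (X^∨)) ∘ ascV Y (Y^∨) (X^∨) ∘ (idm Y ⊠ (dual_tensV X Y ∘ c)).
apply: (@tr_eq0 _ _ j X Y (X^∨) b s) => //.
rewrite /s; pack; rewrite arr_kappa acomp_whiskerl // -!acompA; congr (_ • _).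
by rewrite -atensA atens_id atens_rl // atens_comp // aidl.
Qed.

Lemma tr_tilde_ch_unit : tr j (tilde (ch Z j unit1)) = global_dim j V.
Proof.
(* The dimension of the unit object is a nonzero idempotent scalar. *)
have d1 : pdim j unit1 = 1.
  apply: (mulfI (pdim_simple_neq0 j V_repr unit_simple unit_simple)).
  by rewrite pdim_unit_idem mulr1.
rewrite tilde_ch_unit d1 scale1r -iota_sum linear_sum; apply: eq_bigr => l _.
by rewrite /= trC pi1_iota theta_refl -pdim_tr pdim_tens mulrC.
Qed.

End AdjointDecomposition.

(** * Idempotents in the center *)

Section Center.
Context (k : fieldType) (C : fusionCat k).
Implicit Types X Y : C.
Implicit Types L M N P : zpair C.

Lemma center_hom_comp M N P (g : hom N P) (f : hom M N) :
  center_hom g -> center_hom f -> center_hom (g ∘ f).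
Proof.
move=> cg cf X; rewrite tens_comp_idl tens_comp_idr -compA cf compA cg.
by rewrite compA.
Qed.

(** The image of [q] is the kernel of [idm X - q]. *)
Lemma idempotent_split X (q : hom X X) : q ∘ q = q ->
  exists K (i : hom K X) (p : hom X K), p ∘ i = idm K /\ i ∘ p = q.
Proof.
move=> qq; have [_ [/(_ _ _ (idm X - q))[K [i [i0 univ]]] _ _ _]] := fusion_abelian C.
have [|p [Ep _]] := univ _ q; first by rewrite compBl compIm qq subrr.
exists K, i, p; split=> //.
have Ei : q ∘ i = i by apply/esym/subr0_eq; rewrite -[X in X - _]compIm -compBl.
have [|x [_ U]] := univ _ i; first by [].
by rewrite -(U (p ∘ i)) ?compA ?Ep // -(U (idm K)) // compmI.
Qed.

Section Retract.
Context (M : zpair C) (K : C) (i : hom K M) (p : hom M K).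
Hypotheses (pi1 : p ∘ i = idm K) (center_ip : center_hom (i ∘ p)) (cM : in_center M).

Definition retract_zpair : zpair C :=
  @ZPair k C K (fun X => (idm X ⊠ p) ∘ zbr M X ∘ (i ⊠ idm X)).

Lemma center_hom_retract : @center_hom k C retract_zpair M i.
Proof.
move=> X /=; rewrite !compA -tens_comp_idl center_ip -compA -tens_comp_idr.
by rewrite -compA pi1 compmI.
Qed.

(** As [i ∘ p] commutes with the half-braiding of [M], its occurrences between braidings can be
    moved to an end, where [p ∘ i = idm K] absorbs them. *)
Lemma in_center_retract : in_center retract_zpair.
Proof.
have [br_iso br_nat br_tens] := cM; split=> [X | X Y f | X Y] /=.
- have [s [sb bs]] := br_iso X; exists ((p ⊠ idm X) ∘ s ∘ (idm X ⊠ i)); split.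
    rewrite !compA -(compA _ (idm X ⊠ i)) -tens_comp_idl -(compA _ (idm X ⊠ _)) center_ip.
    rewrite compA -(compA _ s) sb compmI -!tens_comp_idr.
    by rewrite compA pi1 compIm pi1 tensm_id.
  rewrite !compA -(compA _ (i ⊠ idm X)) -tens_comp_idr -(compA _ (zbr M X)) -center_ip.
  rewrite compA -(compA _ (zbr M X)) bs compmI -!tens_comp_idl.
  by rewrite compA pi1 compIm pi1 tensm_id.
- by rewrite !compA tens_swap -(compA (idm Y ⊠ p)) br_nat compA -!compA tens_swap.
have Ecip W : (aid W ⊛ (⌜i⌝ • ⌜p⌝)) • ⌜zbr M W⌝ = ⌜zbr M W⌝ • ((⌜i⌝ • ⌜p⌝) ⊛ aid W).
  by have /(congr1 Arr) := center_ip W; pack => ->.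
have Epi : ⌜p⌝ • ⌜i⌝ = aid K by rewrite -arr_comp pi1; pack.
rewrite br_tens; apply: arr_inj; pack.
have E : ((aid X ⊛ ⌜i⌝ ⊛ aid Y) • (aid X ⊛ ⌜p⌝ ⊛ aid Y)) • (⌜zbr M X⌝ ⊛ aid Y)
    • (⌜i⌝ ⊛ aid X ⊛ aid Y) = (⌜zbr M X⌝ ⊛ aid Y) • (⌜i⌝ ⊛ aid X ⊛ aid Y).
  rewrite -!atensA -!acomp_whiskerr // -acomp_whiskerl // Ecip.
  by rewrite -acompA -acomp_whiskerr // -acompA Epi aidr.
rewrite !acomp_whiskerl // !acomp_whiskerr // -!atens_id !atensA -!acompA.
by do 2!congr (_ • _); move: E; rewrite -!acompA => ->.
Qed.

End Retract.

(** The splitting of [q] lifts to the center, where simplicity makes its inclusion zero or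
    invertible. *)
Lemma center_simple_idem M (q : hom M M) :
  center_simple M -> center_hom q -> q ∘ q = q -> q = 0 \/ q = idm M.
Proof.
move=> [cM _ simM] cq qq; have [K [i [p [pi1 ip]]]] := idempotent_split qq.
have cip : center_hom (i ∘ p) by rewrite ip.
have [|i0|[_ [g _ [_ ig]]]] := simM (retract_zpair i p) i (in_center_retract pi1 cip cM)
  (center_hom_retract pi1 cip).
- by move=> P a b _ _ _ E; rewrite -(compIm a) -(compIm b) -pi1 -!compA E.
- by left; rewrite -ip i0 comp0m.
by right; rewrite -(compmI q) -ig -ip -compA (compA p) pi1 compIm.
Qed.

Lemma idempotent_with_image_sq L M (e : hom L L) : idempotent_with_image M e -> e ∘ e = e.
Proof. by move=> [i [p [_ _ pi1 <-]]]; rewrite compA -(compA i) pi1 compmI. Qed.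

Lemma commuting_retracts L M N (i : hom M L) (p : hom L M) (i' : hom N L) (p' : hom L N) :
  p ∘ i = idm M -> p' ∘ i' = idm N -> i ∘ p ∘ (i' ∘ p') = i' ∘ p' ∘ (i ∘ p) ->
  (p ∘ i' ∘ (p' ∘ i)) ∘ (p ∘ i' ∘ (p' ∘ i)) = p ∘ i' ∘ (p' ∘ i).
Proof.
move=> pi1 pi1' comm.
transitivity (p ∘ (i' ∘ p' ∘ (i ∘ p)) ∘ (i' ∘ p' ∘ i)); first by rewrite !compA.
rewrite -comm -!compA (compA p i) pi1 compIm; do 2!congr (_ ∘ _).
by rewrite (compA p' i') pi1' compIm.
Qed.

(** Both [b ∘ a] and [a ∘ b] are idempotents of simple objects, hence zero or the identity. If
    [b ∘ a = 0] then [e ∘ e' = 0]; if both are identities, [M] and [N] are isomorphic; the remaining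
    case forces [idm M = 0]. *)
Lemma center_simple_orthogonal L M N (e e' : hom L L) :
  center_simple M -> center_simple N -> ~ center_isomorphic M N ->
  idempotent_with_image M e -> idempotent_with_image N e' -> e ∘ e' = e' ∘ e ->
  e ∘ e' = 0.
Proof.
move=> sM sN nMN [i [p [ci cp pi1 <-]]] [i' [p' [ci' cp' pi1' <-]]] comm.
pose a : hom M N := p' ∘ i; pose b : hom N M := p ∘ i'.
have ca : center_hom a by apply: center_hom_comp.
have cb : center_hom b by apply: center_hom_comp.
have ba2 : (b ∘ a) ∘ (b ∘ a) = b ∘ a by apply: commuting_retracts.
have ab2 : (a ∘ b) ∘ (a ∘ b) = a ∘ b by apply: commuting_retracts.
have [ba0|ba1] := center_simple_idem sM (center_hom_comp cb ca) ba2.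
  have -> : i ∘ p ∘ (i' ∘ p') = i ∘ (b ∘ a) ∘ p; last by rewrite ba0 compm0 comp0m.
  transitivity (i ∘ p ∘ (i' ∘ p') ∘ (i ∘ p)); last by rewrite /a /b !compA.
  rewrite comm -!compA; do 3!congr (_ ∘ _).
  by rewrite compA pi1 compIm.
have [ab0|ab1] := center_simple_idem sN (center_hom_comp ca cb) ab2.
  have [_ id0 _] := sM; case: id0; rewrite -ba1 -ba2.
  by rewrite compA -(compA b) ab0 compm0 comp0m.
by case: nMN; exists a; split=> //; exists b.
Qed.

End Center.

(** * Class functions and the Fourier transform *)

Section ClassFunctions.
Context (k : closedFieldType) (C : fusionCat k) (j : pivotal C).
Context (m : nat) (V : 'I_m.+1 -> C) (V_repr : simple_representatives V).
Hypothesis V_unit : V ord0 = unit1.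
Context (star : 'I_m.+1 -> 'I_m.+1) (star_inv : involutive star).
Hypothesis V_star : forall i, isomorphic (V (star i)) ((V i)^∨).
Context (Z : central_comonad C).
Implicit Types (X Y : C) (f g h : CF Z) (a : CE Z).

Local Notation dimC := (global_dim j V).
Local Notation chi i := (ch Z j (V i)).

Lemma unit_simple : simple (unit1 : C).
Proof. by rewrite -V_unit; apply: simpleV. Qed.

(** The functional T of the key identity. *)
Definition CFtr (f : CF Z) : k := tr j (tilde f).

Lemma CFtr_is_linear : scalar CFtr.
Proof. by move=> a f g; rewrite /CFtr !linearP. Qed.
HB.instance Definition _ := GRing.isLinear.Build k (CF Z) k *%R CFtr CFtr_is_linear.

Lemma CFtr_chi i : CFtr (chi i) = (i == ord0)%:R * dimC.
Proof.
case: eqP => [->|/eqP i0].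
  by rewrite V_unit mul1r; apply: tr_tilde_ch_unit V_repr unit_simple.
rewrite mul0r; apply: (tr_tilde_ch_eq0 Z j V_repr) => t; move: t; rewrite -V_unit => t.
exact: (hom_simpleV V_repr).
Qed.

Lemma CFtr_ch X : CFtr (ch Z j X) = (\dim {: hom unit1 X})%:R * dimC.
Proof.
rewrite (ch_mult Z j V_repr) linear_sum (bigD1 ord0) //= big1 => [|l l0].
  by rewrite addr0 linearZ /= CFtr_chi mul1r /multiplicity V_unit.
by rewrite linearZ /= CFtr_chi (negPf l0) mul0r mulr0.
Qed.

Lemma isomorphic_tensr (X Y Y' : C) : isomorphic Y Y' -> isomorphic (X ⊗ Y) (X ⊗ Y').
Proof.
move=> [f [g [gf fg]]]; exists (idm X ⊠ f), (idm X ⊠ g).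
by split; rewrite -tens_comp_idl ?gf ?fg tensm_id.
Qed.

(** The unit object has multiplicity one or zero in [V i ⊗ (V l)^∨]. Up to the factor [dimC], the
    characters and their duals are dual bases for the form T(f ⋆ g). *)
Lemma CFtr_chi_star i l : CFtr (chi i ∘ tilde (chi (star l))) = (i == l)%:R * dimC.
Proof.
rewrite ch_tilde_ch (ch_iso _ _ (isomorphic_tensr (V i) (V_star l))) CFtr_ch; congr (_ * _).
have [d1 d0] := dim_hom_unit (simpleV V_repr i) (simpleV V_repr l).
case: eqP => [E|il]; first by rewrite d1 // E; exists (idm _), (idm _); rewrite /inverse_of compIm.
by have [_ inj _] := V_repr; rewrite d0 ?mul0r // => /inj.
Qed.

Lemma CF_ind (P : CF Z -> Prop) : (forall (c : k) f g, P f -> P g -> P (c *: f + g)) ->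
  (forall i, P (chi i)) -> forall f, P f.
Proof.
move=> Plin Pchi f; have [x ->] := CF_span j V_repr f.
have P0 : P 0 by have := Plin (-1) _ _ (Pchi ord0) (Pchi ord0); rewrite scaleN1r addNr.
by elim/big_rec: _ => // i g _ Pg; apply: Plin.
Qed.

Lemma tilde_star f g : tilde f ∘ tilde g = tilde (f ∘ tilde g).
Proof.
elim/CF_ind: f => [a f f' Ef Ef'|i].
  by rewrite compDl compZl [tilde (a *: f + f')]linearP compDl compZl Ef Ef' linearP.
elim/CF_ind: g => [a g g' Eg Eg'|l].
  rewrite [tilde (a *: g + g')]linearP compDr compZr Eg Eg'.
  by rewrite compDr compZr [RHS]linearP.
by rewrite tilde_ch_comp ch_tilde_ch.
Qed.

(** The character of the unit object is a left unit for ⋆, so a class function is recovered from its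
    endomorphism. *)
Lemma CF_counit f : ch Z j unit1 ∘ tilde f = f.
Proof.
elim/CF_ind: f => [a f f' Ef Ef'|i].
  by rewrite [tilde _]linearP compDr compZr Ef Ef'.
by rewrite ch_tilde_ch tens1o.
Qed.

Lemma tilde_comm f g : gr_commutative V k -> tilde f ∘ tilde g = tilde g ∘ tilde f.
Proof.
move=> comm.
have mult_comm i l p : (multiplicity V p (V i ⊗ V l))%:R = (multiplicity V p (V l ⊗ V i))%:R :> k.
  (* [d i'] is the class of [V i']; products of such classes expose the multiplicities, compared as
     elements of [k]. *)
  pose d i' : {ffun 'I_m.+1 -> k} := [ffun p => (p == i')%:R].
  have E i' l' : gr_mul V (d i') (d l') p = (multiplicity V p (V i' ⊗ V l'))%:R.
    rewrite ffunE (bigD1 i') //= [X in _ + X]big1 ?addr0 => [|x xi]; last first.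
      by rewrite big1 // => y _; rewrite !ffunE (negPf xi) !mul0r.
    rewrite (bigD1 l') //= big1 ?addr0 => [|y yl]; last first.
      by rewrite !ffunE (negPf yl) mulr0 mul0r.
    by rewrite !ffunE !eqxx !mul1r.
  by rewrite -!E comm.
elim/CF_ind: f => [a f f' Ef Ef'|i].
  by rewrite [tilde (_ + _)]linearP compDl compZl Ef Ef' compDr compZr.
elim/CF_ind: g => [a g g' Eg Eg'|l].
  by rewrite [tilde (_ + _)]linearP compDr compZr Eg Eg' compDl compZl.
rewrite !tilde_ch_comp !(ch_mult Z j V_repr (_ ⊗ _)); congr tilde.
by apply: eq_bigr => p _; rewrite mult_comm.
Qed.

Lemma pairing_is_linear f : scalar (pairing f).
Proof. by move=> a x y; rewrite /pairing compDr compZr linearP. Qed.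
HB.instance Definition _ f :=
  GRing.isLinear.Build k (CE Z) k *%R (pairing f) (pairing_is_linear f).

Lemma pairingDl c f g a : pairing (c *: f + g) a = c * pairing f a + pairing g a.
Proof. by rewrite /pairing compDl compZl linearP. Qed.

Lemma psi_iso a X Y c : isomorphic X Y -> psi a X = c *: idm X -> psi a Y = c *: idm Y.
Proof.
move=> [f [g [gf fg]]] E; rewrite -[psi a Y]compmI -fg compA -psi_nat E.
by rewrite compZr compZl compmI fg.
Qed.

Lemma pairing_ch a X c : psi a X = c *: idm X -> pairing (ch Z j X) a = c * pdim j X.
Proof.
move=> E; rewrite /pairing /ch -compA pi1_psi E tensZl tensm_id compZl compIm compZr.
by rewrite linearZ.
Qed.

Section Fourier.
Context (M : adjoint_algebra Z) (lambda : CF Z).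
Hypotheses (nondegenerate : dimC != 0) (lambda_coint : cointegral M lambda).
Hypothesis lambda_norm : pairing lambda (adj_unit M) = 1.

Lemma chi_unit i : chi i ∘ adj_unit M = pdim j (V i) *: idm unit1.
Proof. by rewrite /ch -compA adj_unitE -[LHS]scalK. Qed.

Lemma star_sum (R : nmodType) (F : 'I_m.+1 -> R) : \sum_i F i = \sum_i F (star i).
Proof. by rewrite (reindex_inj (inv_inj star_inv)). Qed.

Lemma cointegralE : lambda = \sum_i (pdim j (V i) / dimC) *: chi (star i).
Proof.
have [x Ex] := CF_span j V_repr lambda.
(* T(chi_i ⋆ lambda) is computed twice: by the cointegral property and by expanding [lambda] in
   characters. *)
have xE i : x (star i) = pdim j (V i) * x ord0.
  apply: (mulIf nondegenerate).
  have : CFtr (chi i ∘ tilde lambda) = pdim j (V i) * CFtr lambda.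
    by rewrite lambda_coint compA chi_unit compZl compIm linearZ.
  have -> : CFtr lambda = x ord0 * dimC.
    rewrite Ex linear_sum (bigD1 ord0) //= big1 ?addr0 => [|l l0].
      by rewrite linearZ /= CFtr_chi mul1r.
    by rewrite linearZ /= CFtr_chi (negPf l0) mul0r mulr0.
  rewrite mulrA => <-.
  rewrite Ex (star_sum (fun l => x l *: chi l)) linear_sum comp_sumr linear_sum (bigD1 i) //=.
  rewrite big1 ?addr0 => [|l li]; rewrite linearZ /= compZr linearZ /= CFtr_chi_star.
    by rewrite eqxx mul1r.
  by rewrite eq_sym (negPf li) mul0r mulr0.
(* Pairing the expansion with the algebra unit produces [x ord0] times the global dimension, which
   the normalization sets to 1. *)
have x0 : x ord0 = dimC^-1.
  apply: (mulIf nondegenerate); rewrite mulVf // -lambda_norm Ex.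
  rewrite (star_sum (fun l => x l *: chi l)) /pairing comp_suml linear_sum /=.
  rewrite /global_dim mulr_sumr; apply: eq_bigr => i _.
  rewrite compZl chi_unit linearZ /= scalZid xE (pdim_iso j (V_star i)).
  by rewrite [RHS]mulrAC [RHS]mulrC; congr (_ * _); apply: mulrC.
by rewrite Ex (star_sum (fun l => x l *: chi l)); apply: eq_bigr => i _; rewrite xE x0.
Qed.

Lemma fourierE a :
  fourier M lambda a = \sum_i (pairing (chi i) a / dimC) *: chi (star i).
Proof.
rewrite /fourier {1}cointegralE -2!compA comp_suml; apply: eq_bigr => i _.
have [c Ec] := schur_end (psi a (V i)) (simpleV V_repr i).
(* The antipode transposes, so it carries the scalar [c] over to the dual object. *)
have Es : psi (antipode M a) (V (star i)) = c *: idm _.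
  apply: psi_iso (isomorphic_sym (V_star i)) _.
  by rewrite psi_antipode Ec linearZ /= dualm_id.
rewrite (pairing_ch Ec) compZl /ch -compA (compA (adj_mul M)) psi_mul Es.
rewrite tensZl tensm_id compZl compIm compZr scalerA; congr (_ *: _).
by rewrite mulrC mulrA.
Qed.

Lemma CFtr_fourier f a : CFtr (f ∘ tilde (fourier M lambda a)) = pairing f a.
Proof.
elim/CF_ind: f => [c f g Ef Eg|i].
  by rewrite compDl compZl pairingDl linearP /= Ef Eg.
rewrite fourierE linear_sum comp_sumr linear_sum (bigD1 i) //= big1 => [|l li].
  by rewrite addr0 linearZ /= compZr linearZ /= CFtr_chi_star eqxx mul1r divfK.
by rewrite linearZ /= compZr linearZ /= CFtr_chi_star eq_sym (negPf li) mul0r mulr0.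
Qed.

(** These central elements act as the identity on [V l] and as zero on the other representatives. *)
Lemma pairing_iota i l :
  pairing (chi i) (iota Z V_repr l ∘ coev (V l)) = (i == l)%:R * pdim j (V i).
Proof.
rewrite /pairing /ch -compA (compA (pi1 Z _)) pi1_iota.
case: eqP => [->|/eqP il]; first by rewrite theta_refl compIm mul1r.
by rewrite theta_neq 1?eq_sym // comp0m compm0 linear0 mul0r.
Qed.

Lemma fourier_surj h : exists a, fourier M lambda a = h.
Proof.
have [y Ey] := CF_span j V_repr h.
(* The coefficients solve [fourierE] for prescribed values; dimensions of simple objects are
   nonzero. *)
exists (\sum_l (y (star l) * dimC / pdim j (V l)) *: (iota Z V_repr l ∘ coev (V l))).
rewrite fourierE Ey [RHS](star_sum (fun l => y l *: chi l)); apply: eq_bigr => i _.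
congr (_ *: _); rewrite linear_sum (bigD1 i) //= big1 => [|l li].
  rewrite addr0 linearZ /= pairing_iota eqxx mul1r divfK ?mulfK //.
  exact: (pdim_simple_neq0 j V_repr unit_simple (simpleV V_repr i)).
by rewrite linearZ /= pairing_iota eq_sym (negPf li) mul0r mulr0.
Qed.

(** [fourier_inv] is a right inverse on the image of a linear map, so linearity and surjectivity are
    both called for. *)
Lemma fourier_invK h : fourier M lambda (fourier_inv M lambda h) = h.
Proof.
have lin : linear (fourier M lambda).
  move=> c a b; rewrite !fourierE scaler_sumr -big_split; apply: eq_bigr => i _ /=.
  by rewrite linearP /= mulrDl scalerDl scalerA mulrA.
pose F : {linear CE Z -> CF Z} :=
  HB.pack (fourier M lambda) (GRing.isLinear.Build k _ _ _ _ lin).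
have [a Ea] := fourier_surj h.
have : linfun F ((linfun F)^-1%VF h) = h.
  by apply: limg_lfunVK; apply/memv_imgP; exists a; rewrite ?memvf // lfunE.
by rewrite lfunE.
Qed.

End Fourier.
End ClassFunctions.

(** * The basis of idempotents and the orthogonality relations *)

Theorem corollary6p11
    (k : closedFieldType) (C : fusionCat k) (j : pivotal C)
    (m : nat) (V : 'I_m.+1 -> C)
    (V_repr : simple_representatives V) (V_unit : V ord0 = unit1)
    (star : 'I_m.+1 -> 'I_m.+1) (star_inv : involutive star)
    (V_star : forall i, isomorphic (V (star i)) ((V i)^∨))
    (nondegenerate : global_dim j V != 0)
    (Gr_comm : gr_commutative V k)
    (Z : central_comonad C) (A : adjoint_algebra Z)
    (lambda : CF Z) (lambda_coint : cointegral A lambda)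
    (lambda_norm : pairing lambda (adj_unit A) = 1)
    (K : 'I_m.+1 -> zpair C) (K_classes : conjugacy_classes Z K)
    (f : 'I_m.+1 -> CF Z) (f_idem : forall r, class_idempotent (K r) (f r)) :
  let chi i := ch Z j (V i) in
  let g r := norm_class_sum j A lambda (K r) (f r) in
  [/\ forall i i' : 'I_m.+1,
        \sum_(r < m.+1) class_size j (K r) / global_dim j V
            * pairing (chi i) (g r) * pairing (chi (star i')) (g r)
        = (i == i')%:R,
      forall r s : 'I_m.+1,
        \sum_(i < m.+1) class_size j (K r) / global_dim j V
            * pairing (chi i) (g r) * pairing (chi (star i)) (g s)
        = (r == s)%:R
    & forall i : 'I_m.+1,
        chi i = \sum_(r < m.+1) pairing (chi i) (g r) *: f r].
Proof.
move=> chi g; have [Kc Kinj _ _] := K_classes.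
set dC := global_dim j V in nondegenerate *.
have simK r : center_simple (K r) by case: (Kc r).
(* The product is lifted to endomorphisms by [tilde], where the idempotents are orthogonal, and
   brought back by the counit. *)
have idem r s : f r ∘ tilde (f s) = (r == s)%:R *: f r.
  rewrite -(CF_counit j V_repr (f r ∘ _)) -(tilde_star j V_repr).
  have [<-|rs] := eqVneq r s.
    by rewrite (idempotent_with_image_sq (f_idem r)) (CF_counit j V_repr) scale1r.
  rewrite (center_simple_orthogonal (simK r) (simK s) _ (f_idem r) (f_idem s)).
  - by rewrite compm0 scale0r.
  - by move=> /Kinj E; rewrite E eqxx in rs.
  exact: (tilde_comm j V_repr _ _ Gr_comm).
have CFtr_f r : CFtr j (f r) = class_size j (K r).
  have [i [p [_ _ pi1 E]]] := f_idem r.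
  by rewrite /CFtr -E trC pi1 -pdim_tr.
have f_neq0 r : f r != 0.
  apply/eqP => f0; have [i [p [_ _ pi1 E]]] := f_idem r.
  have [_ id0 _] := simK r; case: id0.
  by rewrite -[idm _]compIm -pi1 -compA (compA i) E f0 linear0 comp0m compm0.
have f_free : free [tuple f r | r < m.+1].
  apply/freeP => c E s; have /(congr1 (fun h => f s ∘ tilde h)) := E.
  rewrite linear0 compm0 linear_sum comp_sumr (bigD1 s) //= big1 => [|r rs].
    rewrite addr0 (nth_mktuple _ _ s) linearZ /= compZr idem eqxx scale1r.
    by move=> /eqP; rewrite scaler_eq0 (negPf (f_neq0 s)) orbF => /eqP.
  by rewrite (nth_mktuple _ _ r) linearZ /= compZr idem eq_sym (negPf rs) scale0r scaler0.
have f_span h : exists c : 'I_m.+1 -> k, h = \sum_r c r *: f r.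
  (* The [m.+1] characters span, so [m.+1] independent class functions fill the space. *)
  have full : (<<[tuple f r | r < m.+1]>> = fullv)%VS.
    apply/eqP; rewrite eqEdim subvf (eqnP f_free) size_tuple.
    suff -> : fullv = <<[tuple chi i | i < m.+1]>>%VS :> {vspace CF Z}.
      by rewrite (leq_trans (dim_span _)) // size_tuple.
    apply/eqP; rewrite eqEsubv subvf andbT; apply/subvP => h' _.
    have [x ->] := CF_span j V_repr h'; apply: memv_suml => i _.
    by rewrite memvZ // memv_span //; apply/tnthP; exists i; rewrite tnth_mktuple.
  have : h \in <<[tuple f r | r < m.+1]>>%VS by rewrite full memvf.
  move=> /coord_span ->; exists (fun r => coord [tuple f r | r < m.+1] r h).
  by apply: eq_bigr => r _; rewrite (nth_mktuple _ _ r).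
pose a r := class_sum A lambda (f r).
have fourier_a r : fourier A lambda (a r) = f r.
  exact: (fourier_invK V_repr V_unit star_inv V_star nondegenerate lambda_coint lambda_norm).
have pairing_a h r : pairing h (a r) = CFtr j (h ∘ tilde (f r)).
  rewrite -(fourier_a r); symmetry.
  exact: (CFtr_fourier V_repr V_unit star_inv V_star nondegenerate lambda_coint lambda_norm).
(* If the size vanished, T(chi_i ⋆ f_r) would be zero for all [i]; these are the Fourier
   coefficients of [f r] up to [dC], so [f r] would vanish. *)
have size_neq0 r : class_size j (K r) != 0.
  apply/eqP => K0; have /eqP[] := f_neq0 r.
  rewrite -fourier_a (fourierE V_repr V_unit star_inv V_star nondegenerate lambda_coint lambda_norm).
  apply: big1 => i _; rewrite pairing_a.
  have [c ->] := f_span (ch Z j (V i)).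
  rewrite comp_suml linear_sum big1 ?mul0r ?scale0r // => s _ /=.
  rewrite compZl idem !linearZ /=; case: eqVneq => [->|_]; last by rewrite mul0r mulr0.
  by rewrite CFtr_f K0 !mulr0.
(* Division by the size makes the [g r] dual to the [f s]. *)
have pairing_fg s r : pairing (f s) (g r) = (s == r)%:R.
  rewrite /g /norm_class_sum linearZ /= pairing_a idem linearZ /= CFtr_f.
  by case: eqVneq => [->|_]; rewrite ?mul1r ?mul0r ?mulr0 ?mulVf.
have expand h : h = \sum_r pairing h (g r) *: f r.
  have [c Ec] := f_span h; rewrite {1}Ec; apply: eq_bigr => r _; congr (_ *: _).
  rewrite Ec /pairing comp_suml linear_sum (bigD1 r) //= big1 => [|s sr].
    by rewrite addr0 compZl linearZ /= -/(pairing _ _) pairing_fg eqxx mulr1.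
  by rewrite compZl linearZ /= -/(pairing _ _) pairing_fg (negPf sr) mulr0.
have CFtr_star h h' : CFtr j (h ∘ tilde h') =
    \sum_r pairing h (g r) * (pairing h' (g r) * class_size j (K r)).
  rewrite {1}(expand h) comp_suml linear_sum; apply: eq_bigr => r _.
  rewrite compZl linearZ /=; congr (_ * _).
  rewrite {1}(expand h') linear_sum comp_sumr linear_sum (bigD1 r) //= big1 => [|s sr].
    by rewrite addr0 linearZ /= compZr linearZ /= idem eqxx scale1r CFtr_f.
  by rewrite linearZ /= compZr linearZ /= idem eq_sym (negPf sr) scale0r linear0 mulr0.
(* The form T(chi_i ⋆ chi_i'), known from the duality of characters, is expanded in the
   idempotents. *)
have first i i' : \sum_(r < m.+1) class_size j (K r) / dC
    * pairing (chi i) (g r) * pairing (chi (star i')) (g r) = (i == i')%:R.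
  apply: (mulIf nondegenerate); rewrite mulr_suml.
  rewrite -(CFtr_chi_star j V_repr V_unit V_star Z) CFtr_star; apply: eq_bigr => r _.
  rewrite mulrAC (mulrAC _ _ dC) divfK //.
  by rewrite [RHS]mulrA [RHS]mulrC mulrA.
split=> // r s.
(* The first relation says that [Q] is a right inverse of the square matrix [P], hence also a left
   inverse; reindexing by [star] gives the second relation. *)
pose P : 'M[k]_m.+1 := \matrix_(i, r) pairing (chi i) (g r).
pose Q : 'M[k]_m.+1 :=
  \matrix_(r, i) (class_size j (K r) / dC * pairing (chi (star i)) (g r)).
have /mulmx1C/matrixP/(_ r s) : P *m Q = 1%:M.
  apply/matrixP => i i'; rewrite !mxE -first; apply: eq_bigr => t _.
  by rewrite !mxE mulrCA mulrA.
rewrite !mxE => <-; rewrite (star_sum star_inv); apply: eq_bigr => i _.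
by rewrite !mxE star_inv.
Qed.
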